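(* Let $K$ be an algebraically closed field (of any characteristic), let $n\geq 2$ and $\underline{x}=(x_1,\ldots,x_n)$. Let $P\in K[\underline{x}]$ be a non-constant polynomial and, for some $\ell\geq 2$, let $Q_1,\ldots,Q_\ell$ be $\ell$ monomials of degree $\leq\deg(P)$ such that $P,Q_1,\ldots,Q_\ell$ are relatively prime (and pairwise distinct up to multiplicative constants). Assume that the monomials of $P$ together with $Q_1,\ldots,Q_\ell$ do not lie on a line in their Newton representation. If $\mathrm{char}(K)=p>0$, assume further that at least one of $P,Q_1,\ldots,Q_\ell$ is not a $p$-th power in $K[\underline{x}]$. Then $P+\lambda_1Q_1+\cdots+\lambda_\ell Q_\ell$ is generically irreducible, and so $P+\lambda_1^\ast Q_1+\cdots+\lambda_\ell^\ast Q_\ell$ is irreducible in $K[\underline{x}]$ for all $(\lambda_1^\ast,\ldots,\lambda_\ell^\ast)$ in a non-empty Zariski open subset of $K^\ell$.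
   Context: A monomial is a polynomial $x_1^{a_1}\cdots x_n^{a_n}$ with $a_i\in\mathbb{N}$ (exponents may be $0$; $1$ is a monomial). ''$P,Q_1,\ldots,Q_\ell$ relatively prime'' means that no non-constant polynomial divides all of them simultaneously. The Newton representation of a polynomial is the set of points $(a_1,\ldots,a_n)\in\mathbb{N}^n$ such that $x_1^{a_1}\cdots x_n^{a_n}$ appears in it with non-zero coefficient; the condition about a line means that the exponent vectors of the monomials appearing in $P$ together with those of $Q_1,\ldots,Q_\ell$ are not all contained in one affine line of $\mathbb{Q}^n$. With $\underline{\lambda}=(\lambda_1,\ldots,\lambda_\ell)$ independent indeterminates, ''generically irreducible'' means irreducible in $\overline{K(\underline{\lambda})}[\underline{x}]$, where $\overline{K(\underline{\lambda})}$ is an algebraic closure of $K(\underline{\lambda})$. *)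

(* Defs.v *)
From mathcomp Require Import all_boot all_order all_algebra.
From mathcomp Require Export mpoly.
Set Implicit Arguments.
Unset Strict Implicit.
Unset Printing Implicit Defensive.

Import GRing.Theory.

Local Open Scope ring_scope.

(* Library polynomials have [msize p = degree + 1], with [msize 0 = 0]; here the
   zero polynomial also gets degree 0. *)
Definition tdeg (R : idomainType) (n : nat) (p : {mpoly R[n]}) : nat :=
  (msize p).-1.

Definition divides (R : idomainType) (d p : R) : Prop := exists c : R, p = c * d.

Definition irreducible (R : idomainType) (p : R) : Prop :=
  [/\ p != 0, p \isn't a GRing.unit &
      forall a b : R, p = a * b -> a \is a GRing.unit \/ b \is a GRing.unit].

Definition is_monomial (R : idomainType) (n : nat) (q : {mpoly R[n]}) : Prop :=
  exists m : 'X_{1..n}, q = 'X_[m].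

Definition equal_up_to_const (R : idomainType) (n : nat)
    (p q : {mpoly R[n]}) : Prop :=
  exists2 c : R, c != 0 & p = c *: q.

Definition is_pth_power (R : idomainType) (p : nat) (f : R) : Prop :=
  exists g : R, f = g ^+ p.

Section Family.

Variables (K : closedFieldType) (n l : nat).
Variables (P : {mpoly K[n]}) (Q : 'I_l -> {mpoly K[n]}).

Definition relatively_prime : Prop :=
  forall D : {mpoly K[n]},
    divides D P -> (forall i, divides D (Q i)) -> tdeg D = 0%N.

Definition pairwise_distinct : Prop :=
  (forall i, ~ equal_up_to_const P (Q i)) /\
  (forall i j, i != j -> ~ equal_up_to_const (Q i) (Q j)).

Definition newton_points (m : 'X_{1..n}) : Prop :=
  m \in msupp P \/ exists i, m \in msupp (Q i).

Definition on_a_line (S : 'X_{1..n} -> Prop) : Prop :=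
  exists a d : 'rV[rat]_n, d != 0 /\
    forall m, S m -> exists t : rat, \row_(i < n) (m i)%:R = a + t *: d.

(* The constants K(lambda) of the generic polynomial; the indeterminate
   lambda_i is the image of 'X_i. *)
Definition param_field : fieldType := {fraction {mpoly K[l]}}.

Definition param_const (c : K) : param_field :=
  @tofrac {mpoly K[l]} c%:MP.

Definition lambda (i : 'I_l) : param_field :=
  @tofrac {mpoly K[l]} 'X_i.

Definition generic_poly : {mpoly param_field[n]} :=
  map_mpoly param_const P +
  \sum_(i < l) lambda i *: map_mpoly param_const (Q i).

Definition specialized_poly (v : 'I_l -> K) : {mpoly K[n]} :=
  P + \sum_(i < l) v i *: Q i.

End Family.

Definition is_algebraic_closure (F : fieldType) (L : closedFieldType)
    (iota : {rmorphism F -> L}) : Prop :=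
  forall z : L, algebraicOver iota z.

(* The library has no algebraic closure of an arbitrary field, so irreducibility
   over "the" algebraic closure is asserted for every algebraic closure; they are
   all isomorphic over F. *)
Definition irreducible_over_closure (F : fieldType) (n : nat)
    (p : {mpoly F[n]}) : Prop :=
  forall (L : closedFieldType) (iota : {rmorphism F -> L}),
    is_algebraic_closure iota -> irreducible (map_mpoly iota p).

Definition zariski_open (K : fieldType) (l : nat) (U : ('I_l -> K) -> Prop) : Prop :=
  exists I : {mpoly K[l]} -> Prop,
    forall v : 'I_l -> K, U v <-> exists2 f, I f & f.@[v] != 0.

(* Main.v *)
From HB Require Import structures.
Require Import Defs.
From mathcomp Require Import all_boot all_order all_algebra ring zify.
Set Implicit Arguments.
Unset Strict Implicit.
Unset Printing Implicit Defensive.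
Import GRing.Theory.
Local Open Scope ring_scope.

(** Everything follows from a single nonzero polynomial g in the parameters
    such that, for every algebraically closed extension L of K and every point
    v over L with g(v) <> 0, the member F_v = P + sum_i v_i Q_i of the family
    is irreducible over L ([specialized_irreducible]).  For L an algebraic closure
    of K(lambda) and v = lambda, the value g(lambda) is nonzero because the
    lambda_i are independent, which gives generic irreducibility; for L = K the
    locus g <> 0 is the required open set.  So g is constructed for all L at
    once, and no specialization theorem for irreducibility has to be invoked.

    Reduction to two variables.  Substitute y^(w_k) for x_k, with an extra
    factor x^J for one index j0, where the weights w are injective on the
    exponents that can occur in a factor of F_v.  A factor whose image has a
    single power of y is then a monomial, and relative primality excludes
    nonconstant monomial factors.  The weights come from an expansion in a base
    that can be made divisible by the characteristic, so that the hypothesis on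
    p-th powers yields two y-exponents that differ in K
    ([separating_weights]).  For two of the monomials, say Q_1 and Q_2, J is
    the difference of their weights, so that the image of Q_2 / Q_1 is the J-th
    power of x^k y for some integer k.  The index j0 is provided by the
    hypothesis that the exponents are not on a line ([supp_off_line]).

    Two variables ([family_irreducible]).  Consider the members passing through
    the point (1, t): solving for the parameter of Q_1 makes t a free parameter
    in its place.  For general parameters (1, t) is a simple zero in the
    y-direction, so that a formal arc y = y(x) lies on the curve through this
    point, and its coefficients can be taken in the parameter ring itself
    ([hensel_arc]).  If F_v = A B over L, exactly one factor vanishes at the
    point, and this factor vanishes along the whole arc.  Vanishing to order N
    along the arc is a system of linear equations on the coefficients of a
    polynomial of smaller y-degree, with entries in the parameter ring; as soon
    as a maximal minor of it is nonzero at v, no such factor exists.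

    It remains to see that some maximal minor is a nonzero polynomial, and for
    this all parameters but the one of Q_2 may be given general values in K
    ([kernel_minor]).  The curve then moves in a pencil c0 + lambda c1.  If A
    has smaller y-degree and vanishes to high order along the arc, so does the
    resultant of A and c0 + lambda c1 with respect to y, which is a polynomial
    in x of bounded degree; hence it is zero and there is a common factor
    ([arc_kernel_trivial]).  But a pencil with coprime c0 and c1 is linear in
    lambda, so it has no factor over K(lambda), by Gauss's lemma
    ([pencil_no_factor]).  The coprimality is checked on the explicit roots of
    c1 ([based_coprime]).

    Finally, a resultant turns the condition on t and the other parameters into
    the condition g(v) <> 0 ([root_transfer]): outside its zeros, some root t
    of F_v(1, y) satisfies the condition. *)

(** * Formal arcs on a plane curve *)

(** A is a polynomial in y with coefficients in the polynomials in x; the arc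
    is given by two power series truncated to polynomials in u. *)
Definition arc_eval (T : comNzRingType) (x y : {poly T}) (A : {poly {poly T}}) :
    {poly T} :=
  (map_poly (comp_poly x) A).[y].

Section ArcEval.
Variables (T : comNzRingType) (x y : {poly T}).

Lemma arc_evalM A B : arc_eval x y (A * B) = arc_eval x y A * arc_eval x y B.
Proof. by rewrite /arc_eval rmorphM hornerM. Qed.

Lemma arc_evalD A B : arc_eval x y (A + B) = arc_eval x y A + arc_eval x y B.
Proof. by rewrite /arc_eval rmorphD hornerD. Qed.

Lemma arc_evalC p : arc_eval x y p%:P = p \Po x.
Proof. by rewrite /arc_eval map_polyC hornerC. Qed.

Lemma arc_eval_const A :
  (arc_eval x y A).[0] = (A.[(y.[0])%:P]).[x.[0]].
Proof.
rewrite /arc_eval -[LHS]horner_evalE -horner_map /= -map_poly_comp /=.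
rewrite -[RHS]horner_evalE -horner_map /= !horner_evalE hornerC.
by congr (_.[_]); apply: eq_map_poly => p; rewrite /= !horner_evalE horner_comp.
Qed.

End ArcEval.

Lemma map_arc_eval (T S : comNzRingType) (f : {rmorphism T -> S})
    (x y : {poly T}) A :
  map_poly f (arc_eval x y A) =
  arc_eval (map_poly f x) (map_poly f y) (map_poly (map_poly f) A).
Proof.
rewrite /arc_eval -horner_map; congr (_.[_]).
rewrite -!map_poly_comp; apply: eq_map_poly => p /=.
by rewrite map_comp_poly.
Qed.

Section Hensel.
Variable T : comNzRingType.

Lemma poly_taylor2 (p : {poly T}) (a : T) :
  exists q, p = p.[a]%:P + p^`().[a] *: ('X - a%:P) + q * ('X - a%:P) ^+ 2.
Proof.
have /factor_theorem[q1 e1] : root (p - p.[a]%:P) a.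
  by rewrite rootE hornerD hornerN hornerC subrr.
have /factor_theorem[q2 e2] : root (q1 - q1.[a]%:P) a.
  by rewrite rootE hornerD hornerN hornerC subrr.
have d : p^`().[a] = q1.[a].
  have /(congr1 (fun r => r^`().[a])) := e1.
  rewrite derivB derivC subr0 => ->.
  by rewrite derivM derivXsubC !hornerE subrr mulr0 add0r.
exists q2; rewrite d.
have -> : q2 * ('X - a%:P) ^+ 2 = (q1 - q1.[a]%:P) * ('X - a%:P).
  by rewrite e2 expr2 mulrA.
by rewrite mulrBl -e1 mul_polyC addrACA subrr addr0 addrC subrK.
Qed.

Lemma dvd_horner_sub (p : {poly T}) (a b : T) :
  exists c, p.[a] - p.[b] = c * (a - b).
Proof.
have /factor_theorem[q e] : root (p - p.[b]%:P) b.
  by rewrite rootE hornerD hornerN hornerC subrr.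
exists q.[a]; have := congr1 (fun r => r.[a]) e.
by rewrite hornerD hornerN hornerC hornerM hornerXsubC.
Qed.

End Hensel.

(** The map z |-> - h - u H(z) contracts u-adically, so iterating it from 0
    gains one power of u at each step. *)
Lemma contraction_solve (T : comNzRingType) (h : {poly T})
    (H : {poly {poly T}}) (N : nat) :
  exists z q, h + z + 'X * H.[z] = 'X^N * q.
Proof.
elim: N => [|N [z [q E]]]; first by exists 0, (h + 0 + 'X * H.[0]); rewrite mul1r.
exists (- h - 'X * H.[z]).
(* The successive differences z' - z are divisible by u^N. *)
have [c Ec] := dvd_horner_sub H (- h - 'X * H.[z]) z.
exists (- (c * q)).
have -> : h + (- h - 'X * H.[z]) = - ('X * H.[z]) by rewrite addrA subrr add0r.
have D : - h - 'X * H.[z] - z = - ('X^N * q).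
  by rewrite -E !opprD addrAC.
rewrite addrC -mulrBr Ec D exprS.
ring.
Qed.

(** Hensel's lemma without denominators.  With x = 1 + d^2 u and y = t + d u
    z, where d is the y-derivative at the base point, Taylor expansion gives
    G(x, y) = d^2 u (s + z + u H(z)), and the factor in parentheses is solved
    for z over the ring itself.  Staying in the ring is what allows the
    parameters to be specialized afterwards. *)
Lemma hensel_arc (T : comNzRingType) (G : {poly {poly T}}) (t : T)
    (d := (G^`()).[t%:P].[1]) :
  (G.[t%:P]).[1] = 0 ->
  forall N, exists y : {poly T}, y.[0] = t /\
    exists q, arc_eval (1 + d ^+ 2 *: 'X) y G = 'X^N * q.
Proof.
move=> G0 N; set x := 1 + _.
pose g := map_poly (comp_poly x) G.
have x1 : x - 1 = d ^+ 2 *: 'X by rewrite /x addrAC subrr add0r.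
have compE (p : {poly T}) : exists r, p \Po x = p.[1]%:P + r * (d ^+ 2 *: 'X).
  have /factor_theorem[r e] : root (p - p.[1]%:P) 1.
    by rewrite rootE hornerD hornerN hornerC subrr.
  exists (r \Po x); rewrite -x1 -[in LHS](subrK (p.[1]%:P) p) e.
  rewrite comp_polyD comp_polyM comp_polyB comp_polyX !comp_polyC addrC.
  by rewrite polyC1.
have [q Eg] := poly_taylor2 g t%:P.
have g0 : g.[t%:P] = G.[t%:P] \Po x.
  have := @horner_map _ _ (comp_poly x) G t%:P.
  by rewrite /= comp_polyC.
have g1 : g^`().[t%:P] = (G^`()).[t%:P] \Po x.
  rewrite /g deriv_map.
  have := @horner_map _ _ (comp_poly x) (G^`()) t%:P.
  by rewrite /= comp_polyC.
have [s Es] := compE G.[t%:P]; have [r Er] := compE (G^`()).[t%:P].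
move: Es Er; rewrite G0 add0r -/d => Es Er.
pose H : {poly {poly T}} := (r * d%:P) *: 'X + 'X^2 * (q \Po (t%:P%:P + (d *: 'X) *: 'X)).
have [z [w Ew]] := contraction_solve s H N.
exists (t%:P + d *: 'X * z); split; first by rewrite !hornerE; ring.
exists (d ^+ 2 *: 'X * w).
rewrite /arc_eval -/g {}Eg !(hornerD, hornerM, horner_exp, hornerZ, hornerXsubC, hornerC).
rewrite g0 g1 Es Er !hornerN !hornerX !hornerC [t%:P + _ - _]addrAC subrr add0r.
rewrite (_ : 'X^N * _ = d ^+ 2 *: 'X * ('X^N * w)); last by rewrite mulrCA.
rewrite -Ew /H !(hornerD, hornerM, horner_exp, hornerZ, hornerX, hornerC).
rewrite horner_comp !(hornerD, hornerZ, hornerX, hornerC).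
set Q := q.[_]; rewrite -!mul_polyC !rmorphXn /=.
move: Q (polyC d) => Q D.
ring.
Qed.

(** * Pencils of polynomials in one variable *)

Section Gauss.
Variable K : closedFieldType.

Lemma dvd_coefs_root (r : K) (E : {poly {poly K}}) :
  map_poly (horner_eval r) E = 0 ->
  exists2 E', E = ('X - r%:P)%:P * E' & size E' = size E.
Proof.
move=> E0; exists (\poly_(i < size E) (E`_i %/ ('X - r%:P))).
  apply/polyP => i; rewrite coefCM coef_poly; case: ltnP => [lti|lei].
    rewrite mulrC divpK // dvdp_XsubCl rootE.
    by have := congr1 (fun p : {poly K} => p`_i) E0; rewrite coef_map coef0 => /= /eqP.
  by rewrite mulr0 (leq_sizeP _ _ lei).
have [->|nzE] := eqVneq E 0; first by rewrite size_poly0 poly_def big_ord0 size_poly0.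
apply: size_poly_eq; rewrite -/(lead_coef E).
apply: contra_neq nzE => d0.
have: lead_coef E = 0.
  rewrite -(@divpK _ ('X - r%:P) (lead_coef E)) ?d0 ?mul0r //.
  rewrite dvdp_XsubCl rootE.
  have := congr1 (fun p : {poly K} => p`_(size E).-1) E0.
  by rewrite coef_map coef0 => /= /eqP.
by move/eqP; rewrite lead_coef_eq0 => /eqP.
Qed.

(** Gauss's lemma.  As K is algebraically closed, the content c is a product
    of linear factors X - r, and each of them divides E or D because setting X
    = r gives a product in the domain K[y]. *)
Lemma gauss_cancel (c : {poly K}) (g D E : {poly {poly K}}) :
  c != 0 -> c%:P * g = E * D ->
  exists E' D', [/\ g = E' * D', size E' = size E & size D' = size D].
Proof.
have [n] := ubnP (size c); elim: n c D E => // n IH c D E ltn nzc eq.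
have [/size_poly1P[k nzk ck]|/closed_rootP[r /factor_theorem[c' ec]]] :=
    boolP (size c == 1%N).
  exists ((k^-1)%:P%:P * E), D; split=> //.
    by rewrite -mulrA -eq ck mulrA -!rmorphM mulVf //= mul1r.
  by rewrite mul_polyC size_scale // polyC_eq0 invr_neq0.
have nzc' : c' != 0 by apply: contra_neq nzc => e; rewrite ec e mul0r.
have ltc' : (size c' < n)%N.
  by rewrite -ltnS (leq_trans _ ltn) // ec size_Mmonic ?monicXsubC // size_XsubC addn2.
have nzX : ('X - r%:P)%:P != 0 :> {poly {poly K}} by rewrite polyC_eq0 polyXsubC_eq0.
have : map_poly (horner_eval r) E * map_poly (horner_eval r) D = 0.
  rewrite -rmorphM -eq rmorphM /= map_polyC /= ec /horner_eval.
  by rewrite hornerM hornerXsubC subrr mulr0 polyC0 mul0r.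
move/eqP; rewrite mulf_eq0 => /orP[]/eqP/dvd_coefs_root[F EF sF].
- have [|E' [D' [? ? ?]]] := IH c' D F ltc' nzc'.
    by apply: (mulfI nzX); rewrite [RHS]mulrA; rewrite -EF mulrA -rmorphM /= (mulrC _ c') -ec.
  by exists E', D'; split=> //; rewrite -sF.
- have [|E' [D' [? ? ?]]] := IH c' F E ltc' nzc'.
    by apply: (mulfI nzX); rewrite [RHS]mulrCA -EF mulrA -rmorphM /= (mulrC _ c') -ec.
  by exists E', D'; split=> //; rewrite -sF.
Qed.

(** After the content is cancelled, the pencil has degree 1 in its parameter,
    so one of the two factors does not involve the parameter and divides both
    ends of the pencil. *)
Lemma pencil_no_factor (c : {poly K}) (c0 c1 : {poly K}) (D E : {poly {poly K}}) :
  c != 0 -> coprimep c0 c1 -> (1 < size c1)%N ->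
  c%:P * (c0^:P + 'X%:P * c1^:P) = E * D ->
  (size D <= 1)%N \/ (size E <= 1)%N.
Proof.
move=> nzc cop c1_nc /(gauss_cancel nzc)[E' [D' [+ <- <-]]] {c nzc D E}.
(* A factor p without the parameter divides both ends of the pencil. *)
have half p q : coprimep c0 c1 -> c0^:P + 'X%:P * c1^:P = q * p^:P ->
    (size p^:P <= 1)%N.
  move=> cop' e.
  have dvd_coef i : p %| (swapXY q * p%:P)`_i by rewrite coefMC dvdp_mull.
  have {}e : c0%:P + 'X * c1%:P = swapXY q * p%:P.
    rewrite -(swapXY_map_polyC p) -rmorphM -e rmorphD rmorphM /=.
    by rewrite !swapXY_map_polyC swapXY_Y.
  have d0 : p %| c0 by have := dvd_coef 0; rewrite -e coefD coefC coefXM /= addr0.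
  have d1 : p %| c1 by have := dvd_coef 1; rewrite -e coefD coefC coefXM /= coefC add0r.
  rewrite size_map_polyC; have := dvdp_gcd p c0 c1; rewrite d0 d1 => /dvdp_leq.
  by rewrite -size_poly_eq0; move/eqP: cop' => -> /(_ isT).
move=> e.
have nzc1 : c1 != 0 by rewrite -size_poly_gt0 ltnW.
have e' : c0%:P + 'X * c1%:P = swapXY E' * swapXY D'.
  by rewrite -rmorphM -e rmorphD rmorphM /= !swapXY_map_polyC swapXY_Y.
have s2 : size (c0%:P + 'X * c1%:P : {poly {poly K}}) = 2%N.
  by rewrite addrC mulrC size_MXaddC polyC_eq0 (negbTE nzc1) /= size_polyC nzc1.
have nz : swapXY E' * swapXY D' != 0 by rewrite -size_poly_eq0 -e' s2.
have [nzE nzD] : swapXY E' != 0 /\ swapXY D' != 0.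
  by apply/andP; rewrite -negb_or -mulf_eq0.
move: s2; rewrite e' size_mul // => s3.
have sE : (0 < size (swapXY E'))%N by rewrite size_poly_gt0.
have sD : (0 < size (swapXY D'))%N by rewrite size_poly_gt0.
have [sD1|sD1] := leqP (size (swapXY D')) 1.
  have eD : D' = ((swapXY D')`_0)^:P.
    by rewrite -[LHS]swapXYK [in LHS](size1_polyC sD1) swapXY_polyC.
  by left; rewrite eD; apply: (half _ E' cop); rewrite -eD.
have sE1 : (size (swapXY E') <= 1)%N.
  by move: s3 sE sD1; case: (size (swapXY E')) => [|[|k]]; case: (size _) => [|[|m]]; rewrite ?addnS.
have eE : E' = ((swapXY E')`_0)^:P.
  by rewrite -[LHS]swapXYK [in LHS](size1_polyC sE1) swapXY_polyC.
by right; rewrite eE; apply: (half _ D' cop); rewrite -eE [RHS]mulrC.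
Qed.

End Gauss.

(** * Polynomials vanishing along an arc of a pencil *)

Lemma size_det_leq (R : comNzRingType) (n e : nat) (M : 'M[{poly R}]_n) :
  (forall i j, size (M i j) <= e.+1)%N -> (size (\det M) <= (n * e).+1)%N.
Proof.
move=> le_M; apply: leq_trans (size_sum _ _ _) _; apply/bigmax_leqP => s _.
rewrite size_Msign; apply: leq_trans (size_prod_leq _ _) _.
rewrite leq_subLR card_ord addnS ltnS.
apply: (@leq_trans (\sum_(i < n) e.+1)); first by apply: leq_sum => i _; apply: le_M.
by rewrite sum_nat_const card_ord mulnS.
Qed.

Lemma size_resultant_leq (R : comNzRingType) (e : nat) (p q : {poly {poly R}}) :
  (forall i, (size (p`_i)%R <= e.+1)%N) -> (forall i, (size (q`_i)%R <= e.+1)%N) ->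
  (size (resultant p q) <= (((size q).-1 + (size p).-1) * e).+1)%N.
Proof.
move=> le_p le_q; apply: size_det_leq => i j.
rewrite Sylvester_mxE; case: (split i) => k;
  by case: (k <= j)%N; rewrite ?mulr1n ?mulr0n ?size_poly0.
Qed.

Lemma eq0_of_small_multXn (R : nzRingType) (N : nat) (p q : {poly R}) :
  (size p <= N)%N -> p = 'X^N * q -> p = 0.
Proof.
move=> leN e; apply/polyP => i; rewrite coef0.
have [lti|lei] := ltnP i N; first by rewrite e coefXnM lti.
by rewrite (leq_sizeP _ _ leN).
Qed.

(** For h take the leading coefficient of L in its inner variable: where this
    does not vanish, neither does L. *)
Lemma nonroot_bound (K : idomainType) (L : {poly {poly K}}) :
  L != 0 -> exists2 h : {poly K}, h != 0 &
    forall a : K, h.[a] != 0 -> L.[a%:P] != 0.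
Proof.
move=> nzL; exists (lead_coef (swapXY L)); first by rewrite lead_coef_eq0 swapXY_eq0.
move=> a; apply: contra_neq; rewrite horner_polyC => /(congr1 (fun p : {poly K} => p`_(size (swapXY L)).-1)).
by rewrite coef_map coef0.
Qed.

Section Core.
Variable K : closedFieldType.

(** The levels of {poly {poly {poly K}}} are, from the outside, y, x and the
    parameter of the pencil. *)
Definition lift_const : {poly {poly K}} -> {poly {poly {poly K}}} :=
  map_poly (map_poly polyC).

Definition pencil (c0 c1 : {poly {poly K}}) : {poly {poly {poly K}}} :=
  lift_const c0 + 'X%:P%:P * lift_const c1.

(** Besides coprimality of the specialized ends, the second one must involve
    y, so that the specialized pencil is not constant in its parameter. *)
Definition generic_coprime (c0 c1 : {poly {poly K}}) :=
  exists2 h : {poly K}, h != 0 & forall a : K, h.[a] != 0 ->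
    coprimep (map_poly (horner_eval a) c0) (map_poly (horner_eval a) c1) /\
    (1 < size (map_poly (horner_eval a) c1))%N.

Lemma pencil_at (c0 c1 : {poly {poly K}}) (a : K) :
  map_poly (horner_eval a%:P) (pencil c0 c1) =
  (map_poly (horner_eval a) c0)^:P + 'X%:P * (map_poly (horner_eval a) c1)^:P.
Proof.
have E c : map_poly (horner_eval a%:P) (lift_const c) = (map_poly (horner_eval a) c)^:P.
  rewrite /lift_const -!map_poly_comp; apply: eq_map_poly => p /=.
  by rewrite /horner_eval horner_map.
by rewrite rmorphD rmorphM /= !E map_polyC /= /horner_eval hornerC.
Qed.

(** A common factor survives the specialization of x to a general element of
    K, where [pencil_no_factor] applies. *)
Lemma pencil_coprime (c0 c1 : {poly {poly K}}) (A : {poly {poly {poly K}}}) :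
  generic_coprime c0 c1 -> A != 0 -> (size A < size (pencil c0 c1))%N ->
  (size (gcdp A (pencil c0 c1)) <= 1)%N.
Proof.
move=> [h nzh coph] nzA ltA; set g := pencil c0 c1 in ltA *; set D := gcdp A g.
have nzD : D != 0 by rewrite gcdp_eq0 negb_and nzA.
have ltD : (size D < size g)%N.
  by apply: leq_ltn_trans ltA; apply: dvdp_leq => //; apply: dvdp_gcdl.
have nzg : g != 0 by rewrite -size_poly_gt0 (leq_ltn_trans _ ltD).
have /Pdiv.Idomain.dvdpP[[c E] /= nzc e] : D %| g by apply: dvdp_gcdr.
have [h1 nzh1 H1] : exists2 h : {poly K}, h != 0 & forall a : K, h.[a] != 0 ->
   (c * lead_coef D * lead_coef g).[a%:P] != 0.
  by apply: nonroot_bound; rewrite !mulf_neq0 ?lead_coef_eq0.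
have /closed_nonrootP[a] : h * h1 != 0 by rewrite mulf_neq0.
rewrite rootE hornerM mulf_eq0 negb_or => /andP[/coph[cop c1_nc] /H1].
rewrite !hornerM !mulf_eq0 !negb_or -andbA => /and3P[ca Da ga].
pose at_a := map_poly (horner_eval a%:P).
have sD : size (at_a D) = size D by rewrite size_map_poly_id0.
have sg : size (at_a g) = size g by rewrite size_map_poly_id0.
have ea : c.[a%:P]%:P * at_a g = at_a E * at_a D.
  rewrite -rmorphM -e -mul_polyC rmorphM /= map_polyC //.
have nzE : at_a E != 0.
  apply: contra_neq ca => E0; move/eqP: ea; rewrite E0 mul0r mulf_eq0 polyC_eq0.
  by rewrite -(size_poly_eq0 (at_a g)) sg size_poly_eq0 (negbTE nzg) orbF => /eqP.
have [] := pencil_no_factor ca cop c1_nc (D := at_a D) (E := at_a E).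
- by rewrite -pencil_at.
- by rewrite sD.
move=> sE; have : size (c.[a%:P]%:P * at_a g) = size D.
  rewrite ea size_mul // -?size_poly_eq0 ?sD ?size_poly_eq0 //.
  by move: sE; rewrite -size_poly_gt0 in nzE; case: (size _) nzE => [|[|k]].
by rewrite mul_polyC size_scale // sg => eg; move: ltD; rewrite eg ltnn.
Qed.

(** The resultant of A and the pencil lies in the ideal that they generate, so
    it vanishes along the arc to order N; its degree in x is less than N, so
    it is zero. *)
Lemma arc_kernel_trivial (c0 c1 : {poly {poly K}}) (d e N : nat) (del : {poly K})
    (y : {poly {poly K}}) (A : {poly {poly {poly K}}}) (q r : {poly {poly K}})
    (x := 1 + del *: 'X) :
  del != 0 -> generic_coprime c0 c1 -> (0 < d)%N -> size (pencil c0 c1) = d.+1 ->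
  (forall i, (size ((pencil c0 c1)`_i)%R <= e.+1)%N) ->
  ((d + d) * e < N)%N ->
  arc_eval x y (pencil c0 c1) = 'X^N * q ->
  (size A <= d)%N -> (forall i, (size (A`_i)%R <= e.+1)%N) ->
  arc_eval x y A = 'X^N * r ->
  A = 0.
Proof.
move=> nzd cop d_gt0 sg eg ltN arcg sA eA arcA.
have sx : size x = 2%N.
  by rewrite /x addrC -mul_polyC size_MXaddC polyC_eq0 (negbTE nzd) /= size_polyC nzd.
have vanish (p : {poly {poly K}}) (w : {poly {poly K}}) :
    (size p <= N)%N -> p \Po x = 'X^N * w -> p = 0.
  move=> lep ep; have sp := size_comp_poly2 p sx.
  apply/eqP; rewrite -size_poly_eq0 -sp size_poly_eq0; apply/eqP.
  by apply: eq0_of_small_multXn ep; rewrite sp.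
have [sA1|sA1] := leqP (size A) 1.
  rewrite (size1_polyC sA1) in arcA *.
  rewrite arc_evalC in arcA; rewrite (vanish _ _ _ arcA) //.
  by rewrite (leq_trans (eA _)) // (leq_trans _ ltN) // ltnS leq_pmull // addn_gt0 d_gt0.
have nzA : A != 0 by rewrite -size_poly_gt0 ltnW.
have sg1 : (1 < size (pencil c0 c1))%N by rewrite sg.
have res0 : resultant A (pencil c0 c1) = 0.
  have [[u v] /= _ euv] := resultant_in_ideal sA1 sg1.
  apply: (vanish _ (arc_eval x y u * r + arc_eval x y v * q)).
    rewrite (leq_trans (size_resultant_leq eA eg)) // sg /=.
    rewrite (leq_ltn_trans _ ltN) // leq_mul2r leq_add2l; apply/orP; right.
    exact: leq_trans (leq_pred _) sA.
  rewrite -(arc_evalC x y) euv arc_evalD !arc_evalM arcA arcg.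
  by rewrite mulrDr !(mulrCA 'X^N).
have := pencil_coprime cop nzA; rewrite sg ltnS => /(_ sA).
by rewrite leqNgt -resultant_eq0 res0 eqxx.
Qed.

End Core.

(** * The linear system of vanishing along an arc *)

Section MinorOverDomain.
Variable R : idomainType.

Lemma fraction_denominator (x : {fraction R}) :
  exists sn : R * R, (sn.1 != 0) && (x * tofrac sn.1 == tofrac sn.2).
Proof.
elim/quotW: x => x; exists (\d_x, \n_x); rewrite denom_ratioP /=; apply/eqP.
unlock tofrac; rewrite -[LHS]FracField.pi_mul; apply/eqmodP.
rewrite /= FracField.equivfE /FracField.mulf !numden_Ratio ?mulf_neq0 ?oner_eq0 ?denom_ratioP //.
by rewrite !mulr1 mulrC.
Qed.

Lemma common_denominator (m : nat) (u : 'rV[{fraction R}]_m) :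
  exists2 s, s != 0 & exists u', tofrac s *: u = map_mx (@tofrac R) u'.
Proof.
pose sn i := xchoose (fraction_denominator (u 0 i)).
have snP i : (sn i).1 != 0 /\ u 0 i * tofrac (sn i).1 = tofrac (sn i).2.
  by have /andP[? /eqP] := xchooseP (fraction_denominator (u 0 i)).
exists (\prod_i (sn i).1); first by apply/prodf_neq0 => i _; case: (snP i).
exists (\row_i ((sn i).2 * \prod_(j | j != i) (sn j).1)).
apply/rowP => i; rewrite !mxE rmorphM /= -(proj2 (snP i)) (bigD1 i) //= rmorphM /=.
ring.
Qed.

(** Triviality of the kernel passes to the fraction field by clearing
    denominators, and there the rank is given by a minor. *)
Lemma minor_of_trivial_kernel (m N : nat) (M : 'M[R]_(m, N)) :
  (forall u : 'rV_m, u *m M = 0 -> u = 0) ->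
  exists h : 'I_m -> 'I_N, \det (colsub h M) != 0.
Proof.
move=> kerM; pose MF := map_mx (@tofrac R) M.
have freeM : row_free MF.
  rewrite -kermx_eq0; apply/eqP/row_matrixP => i; rewrite row0.
  set v := row i _.
  have vM : v *m MF = 0 by rewrite /v -row_mul mulmx_ker row0.
  have [s nzs [u eu]] := common_denominator v.
  have /kerM u0 : u *m M = 0.
    have /matrixP e0 : map_mx (@tofrac R) (u *m M) = 0.
      by rewrite map_mxM -eu -scalemxAl vM scaler0.
    by apply/matrixP => a b; have := e0 a b; rewrite [LHS]mxE !mxE => /eqP; rewrite tofrac_eq0 => /eqP.
  move/eqP: eu; rewrite u0 map_mx0 scalemx_eq0 tofrac_eq0 (negbTE nzs) /=.
  by move/eqP.
have fullM : row_full MF^T by rewrite /row_full mxrank_tr.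
exists (fullrankfun fullM).
have := fullrowsub_unit fullM; rewrite unitmxE unitfE -det_tr.
have -> : (rowsub (fullrankfun fullM) MF^T)^T =
    map_mx (@tofrac R) (colsub (fullrankfun fullM) M).
  by apply/matrixP => i j; rewrite !mxE.
by rewrite det_map_mx /= tofrac_eq0.
Qed.

End MinorOverDomain.

Section ArcMatrix.
Variables (T : comNzRingType) (dy dx N : nat) (x y : {poly T}).

(** Rows are indexed by the monomials x^i y^j and columns by the coefficients
    of u^k, so that the left kernel consists of the polynomials vanishing
    along the arc to order N. *)
Definition arc_mx : 'M[T]_(dy * dx, N) :=
  (\matrix_k mxvec (\matrix_(j < dy, i < dx) (x ^+ i * y ^+ j)`_k))^T.

Lemma arc_mxP (A : {poly {poly T}}) (k : 'I_N) :
  (size A <= dy)%N -> (forall i, (size (A`_i)%R <= dx)%N) ->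
  (mxvec (\matrix_(j < dy, i < dx) A`_j`_i) *m arc_mx) 0 k = (arc_eval x y A)`_k.
Proof.
move=> sA eA.
have -> : (arc_eval x y A)`_k =
    \sum_(j < dy) \sum_(i < dx) A`_j`_i * (x ^+ i * y ^+ j)`_k.
  rewrite /arc_eval (@horner_coef_wide _ dy); last first.
    exact: leq_trans (size_poly _ _) sA.
  rewrite coef_sum; apply: eq_bigr => j _.
  rewrite coef_map /= comp_polyE mulr_suml coef_sum.
  rewrite (big_ord_widen dx (fun i => (A`_j`_i *: x ^+ i * y ^+ j)`_k)) //.
  rewrite big_mkcond; apply: eq_bigr => i _.
  case: ltnP => [_|/leq_sizeP ->] //; last by rewrite mul0r.
  by rewrite -scalerAl coefZ.
rewrite pair_bigA mxE (reindex _ (curry_mxvec_bij _ _)) /=.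
by apply: eq_bigr => [[j i]] _ /=; rewrite mxvecE !mxE mxvecE !mxE.
Qed.

End ArcMatrix.

Lemma map_arc_mx (T S : comNzRingType) (f : {rmorphism T -> S}) dy dx N x y :
  map_mx f (arc_mx dy dx N x y) = arc_mx dy dx N (map_poly f x) (map_poly f y).
Proof.
apply/matrixP => r k; case/mxvec_indexP: r => j i; rewrite !mxE !mxvecE !mxE.
by rewrite -!rmorphXn -rmorphM coef_map.
Qed.

(** This is applied over an extension of K, after the minor has been
    specialized. *)
Lemma arc_mx_inj0 (T : idomainType) (dy dx N : nat) (x y : {poly T})
    (A : {poly {poly T}}) (h : 'I_(dy * dx) -> 'I_N) (r : {poly T}) :
  \det (colsub h (arc_mx dy dx N x y)) != 0 ->
  (size A <= dy)%N -> (forall i, (size (A`_i)%R <= dx)%N) ->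
  arc_eval x y A = 'X^N * r -> A = 0.
Proof.
move=> nzdet sA eA arcA.
set u := mxvec (\matrix_(j < dy, i < dx) A`_j`_i).
have u0 : u *m arc_mx dy dx N x y = 0.
  apply/rowP => k; rewrite arc_mxP // mxE arcA coefXnM ltn_ord //.
have {}u0 : u = 0.
  apply/eqP; apply: contraNT nzdet => nzu; apply/det0P; exists u => //.
  apply/rowP => k; have /rowP/(_ (h k)) := u0.
  rewrite [LHS]mxE [RHS]mxE => e; rewrite [LHS]mxE [RHS]mxE -[RHS]e.
  by apply: eq_bigr => i _; congr (_ * _); rewrite mxE.
apply/polyP => j; rewrite coef0; apply/polyP => i; rewrite coef0.
have [ltj|/(leq_trans sA)/leq_sizeP->//] := ltnP j dy; last by rewrite coef0.
have [lti|/(leq_trans (eA j))/leq_sizeP->//] := ltnP i dx.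
have /matrixP/(_ (Ordinal ltj) (Ordinal lti)) :
    \matrix_(j < dy, i < dx) A`_j`_i = 0.
  by apply: (can_inj mxvecK); rewrite linear0.
by rewrite !mxE.
Qed.

Lemma arc_mx_kernel (T : comNzRingType) (dy dx N : nat) (x y : {poly T}) :
  (forall (A : {poly {poly T}}) r, (size A <= dy)%N ->
     (forall i, (size (A`_i)%R <= dx)%N) -> arc_eval x y A = 'X^N * r -> A = 0) ->
  forall u : 'rV_(dy * dx), u *m arc_mx dy dx N x y = 0 -> u = 0.
Proof.
move=> triv u u0; pose A : {poly {poly T}} :=
  \poly_(j < dy) \poly_(i < dx) (if insub j is Some j' then
    if insub i is Some i' then vec_mx u j' i' else 0 else 0).
have AE (j : 'I_dy) (i : 'I_dx) : A`_j`_i = vec_mx u j i.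
  by rewrite coef_poly ltn_ord valK coef_poly ltn_ord valK.
have sA : (size A <= dy)%N := size_poly _ _.
have eA i : (size (A`_i)%R <= dx)%N.
  by rewrite coef_poly; case: ifP => _; rewrite ?size_poly0 // size_poly.
have uE : u = mxvec (\matrix_(j < dy, i < dx) A`_j`_i).
  by rewrite -[u]vec_mxK; congr mxvec; apply/matrixP => j i; rewrite [RHS]mxE AE.
have A0 : A = 0.
  apply: (triv _ (drop_poly N (arc_eval x y A))) => //.
  rewrite -[LHS](poly_take_drop N) [RHS]mulrC [take_poly _ _](_ : _ = 0) ?add0r //.
  apply/polyP => k; rewrite coef_take_poly coef0; case: ltnP => // ltk.
  by have := @arc_mxP T dy dx N x y A (Ordinal ltk) sA eA; rewrite -uE u0 mxE /= => <-.
by rewrite uE A0; apply/rowP => k; case/mxvec_indexP: k => j i; rewrite mxvecE !mxE !coef0.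
Qed.

Lemma Xn_dvd_cancel (F : fieldType) (N : nat) (p s q : {poly F}) :
  s.[0] != 0 -> p * s = 'X^N * q -> exists r, p = 'X^N * r.
Proof.
move=> s0 e; have cop : coprimep 'X^N s.
  by case: N {e} => [|N]; rewrite ?expr0 ?coprime1p // coprimep_pexpl // coprimep_sym coprimepX.
have /dvdpP[r ->] : 'X^N %| p by rewrite -(Gauss_dvdpl p cop) e dvdp_mulr.
by exists r; rewrite mulrC.
Qed.

(** * General points and monomial weights *)

Lemma digits_inj (B n : nat) (f g : nat -> nat) :
  (forall k, f k < B)%N -> (forall k, g k < B)%N ->
  (\sum_(k < n) B ^ k * f k = \sum_(k < n) B ^ k * g k)%N ->
  forall k, (k < n)%N -> f k = g k.
Proof.
elim: n f g => [|n IH] f g ltf ltg //.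
have shift (h : nat -> nat) : (\sum_(k < n.+1) B ^ k * h k = B * (\sum_(k < n) B ^ k * h k.+1) + h 0)%N.
  rewrite big_ord_recl expn0 mul1n addnC; congr (_ + _)%N.
  by rewrite big_distrr; apply: eq_bigr => i _; rewrite /= /bump add1n expnS mulnA.
have B_gt0 : (0 < B)%N by apply: leq_ltn_trans (ltf 0%N).
rewrite !shift => e.
have e0 : f 0%N = g 0%N.
  by have := congr1 (modn^~ B) e; rewrite /= !(mulnC B) !modnMDl !modn_small.
move: e; rewrite e0 => /addIn/eqP; rewrite eqn_pmul2l // => /eqP e.
by case=> [|k] // ltk; apply: (IH (f \o succn) (g \o succn)) e k ltk => j; rewrite /=.
Qed.

Definition weight (n : nat) (w : 'I_n -> nat) (m : 'X_{1..n}) : nat :=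
  \sum_(i < n) w i * m i.

Lemma coef_sum_monomials (T : nzRingType) (I : eqType) (s : seq I) (c : I -> T)
    (w : I -> nat) (i : I) :
  uniq s -> {in s &, injective w} -> i \in s ->
  (\sum_(j <- s) c j *: 'X^(w j))`_(w i) = c i.
Proof.
move=> us injw si; rewrite coef_sum (bigD1_seq i) //= coefZ coefXn eqxx mulr1.
rewrite big_seq_cond big1 ?addr0 // => j /andP[sj ne].
rewrite coefZ coefXn [w i == _](_ : _ = false) ?mulr0 //.
by apply: contraNF ne => /eqP/injw ->.
Qed.

Lemma mmap_monomials (K T : comNzRingType) (n : nat) (f : {rmorphism K -> T})
    (w : 'I_n -> nat) (p : {mpoly K[n]}) :
  mmap (polyC \o f) (fun i => 'X^(w i)) p =
  \sum_(m <- msupp p) f p@_m *: 'X^(weight w m).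
Proof.
rewrite /mmap; apply: eq_bigr => m _; rewrite /= mul_polyC /mmap1; congr (_ *: _).
rewrite /weight -[RHS]mul1r.
by elim/big_ind2: _ => [|a b c d ea eb|i _]; rewrite ?expr0 ?mul1r // -?exprM // ea eb !mul1r exprD.
Qed.

Lemma mnm_lt_msize (K : nzRingType) (n : nat) (p : {mpoly K[n]}) m i :
  m \in msupp p -> (m i < msize p)%N.
Proof.
move=> mp; apply: leq_ltn_trans (msize_mdeg_lt mp).
by rewrite mdegE (bigD1 i) //= leq_addr.
Qed.

Lemma rmorph_mmap (n : nat) (K T S : comNzRingType) (g : {rmorphism T -> S})
    (f : {rmorphism K -> T}) (v : 'I_n -> T) (p : {mpoly K[n]}) :
  g (mmap f v p) = mmap (g \o f) (g \o v) p.
Proof.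
rewrite /mmap rmorph_sum; apply: eq_bigr => m _; rewrite rmorphM; congr (_ * _).
by rewrite /mmap1 rmorph_prod; apply: eq_bigr => i _; rewrite rmorphXn.
Qed.

Lemma eq_mmap (n : nat) (K T : comNzRingType) (f1 f2 : K -> T) (v1 v2 : 'I_n -> T) :
  f1 =1 f2 -> v1 =1 v2 -> mmap f1 v1 =1 mmap f2 v2.
Proof.
move=> ef ev p; apply: eq_bigr => m _; rewrite ef; congr (_ * _).
exact: mmap1_eq.
Qed.

(** Kronecker substitution: powers of one variable with exponents in a large
    base keep the monomials apart. *)
Lemma mpoly_nonroot (K : closedFieldType) (n : nat) (p : {mpoly K[n]}) :
  p != 0 -> exists v, p.@[v] != 0.
Proof.
move=> nzp; pose w (i : 'I_n) := (msize p ^ i)%N.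
pose q : {poly K} := mmap (polyC \o idfun) (fun i => 'X^(w i)) p.
have injw : {in msupp p &, injective (weight w)}.
  move=> m1 m2 m1p m2p e; apply/mnmP => i.
  pose d (m : 'X_{1..n}) k := if insub k is Some j then m j else 0%N.
  have dE (m : 'X_{1..n}) (j : 'I_n) : d m j = m j by rewrite /d insubT //= => lt; congr (m _); apply: val_inj.
  have d_lt m k : m \in msupp p -> (d m k < msize p)%N.
    move=> mp; rewrite /d; case: insubP => [j _ _|_]; first exact: mnm_lt_msize.
    by rewrite lt0n msize_poly_eq0.
  rewrite -!dE; apply: (@digits_inj (msize p) n) => //; try by move=> k; exact: d_lt.
  by rewrite -[LHS]/(\sum_(k < n) _)%N; under eq_bigr do rewrite dE; under [RHS]eq_bigr do rewrite dE.
have nzq : q != 0.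
  have mp := mlead_supp nzp.
  apply: contraTneq (mp) => q0; rewrite mcoeff_msupp negbK.
  rewrite -(@coef_sum_monomials _ _ (msupp p) (fun m => p@_m) (weight w)) ?msupp_uniq //.
  by rewrite -(mmap_monomials idfun) -/q q0 coef0.
have [t] := closed_nonrootP _ nzq; rewrite rootE => nzt.
exists (fun i => t ^+ w i); apply: contra_neq nzt => <-.
rewrite -horner_evalE /q rmorph_mmap; apply: eq_mmap => a /=.
  by rewrite horner_evalE hornerC.
by rewrite horner_evalE hornerXn.
Qed.

(** * Moving the base point *)

Definition upd (l : nat) (T : Type) (v : 'I_l -> T) (i : 'I_l) (t : T) : 'I_l -> T :=
  fun j => if j == i then t else v j.

Section Slice.
Variables (l : nat) (K T : comNzRingType) (f : {rmorphism K -> T}) (i : 'I_l).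

(** The restriction of a polynomial to the line through v in the direction of
    the i-th coordinate. *)
Definition slice (v : 'I_l -> T) : {mpoly K[l]} -> {poly T} :=
  mmap (polyC \o f) (upd (fun j => (v j)%:P) i 'X).

HB.instance Definition _ v := GRing.RMorphism.copy (slice v)
  (mmap (polyC \o f) (upd (fun j => (v j)%:P) i 'X)).

Lemma horner_slice v p t : (slice v p).[t] = mmap f (upd v i t) p.
Proof.
rewrite -horner_evalE /slice rmorph_mmap; apply: eq_mmap => a /=.
  by rewrite horner_evalE hornerC.
by rewrite /upd horner_evalE; case: eqP; rewrite ?hornerX ?hornerC.
Qed.

Lemma slice_neq0 v p : mmap f v p != 0 -> slice v p != 0.
Proof.
apply: contra_neq => s0; have := horner_slice v p (v i); rewrite s0 horner0 => ->.
by apply: eq_mmap => // j; rewrite /upd; case: eqP => // ->.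
Qed.

End Slice.

Lemma map_slice (l : nat) (K T S : comNzRingType) (f : {rmorphism K -> T})
    (g : {rmorphism T -> S}) (i : 'I_l) (v : 'I_l -> T) p :
  map_poly g (slice f i v p) = slice (g \o f) i (g \o v) p.
Proof.
rewrite /slice rmorph_mmap; apply: eq_mmap => a /=; first by rewrite map_polyC.
by rewrite /upd; case: eqP => _; rewrite ?map_polyX ?map_polyC.
Qed.

Lemma mmap_id_mpoly (l : nat) (K : comNzRingType) (p : {mpoly K[l]}) :
  mmap (@mpolyC l K) (fun j => 'X_j) p = p.
Proof. by rewrite [RHS]mpolyE; apply: eq_bigr => m _; rewrite mmap1_id mul_mpolyC. Qed.

Section RootTransfer.
Variables (K : closedFieldType) (l : nat) (i : 'I_l).
Local Notation R := {mpoly K[l]}.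

(** A common factor of the two polynomials would give, for general values of
    the parameters, a common root r.  At a root r <> 0 of the slice of F the
    value of W is a nonconstant affine function of the i-th parameter, on
    which the slice does not depend; and r = 0 is excluded since W is nonzero
    there. *)
Lemma common_root_avoid (W : {poly R}) (b : nat) (F : R) :
  W`_0 != 0 ->
  (forall v t, map_poly (meval (upd v i t)) W =
     map_poly (meval (upd v i 0)) W + t *: 'X^b) ->
  F != 0 ->
  resultant W (slice (@mpolyC l K) i (fun j => 'X_j) (F * 'X_i)) != 0.
Proof.
move=> nzW0 linW nzF; set F' := F * 'X_i; set FY := slice _ _ _ _.
apply/negP; rewrite resultant_eq0; set D := gcdp _ _ => D_nc.
have nzX : 'X_i != 0 :> R by rewrite -msize_poly_eq0 msizeX.
have nzF' : F' != 0 by rewrite mulf_neq0.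
have nzFY : FY != 0 by apply: slice_neq0; rewrite mmap_id_mpoly.
have nzD : D != 0 by rewrite -size_poly_gt0 ltnW.
have /Pdiv.Idomain.dvdpP[[c E] /= nzc eW] : D %| W by apply: dvdp_gcdl.
have /Pdiv.Idomain.dvdpP[[c' E'] /= nzc' eF] : D %| FY by apply: dvdp_gcdr.
have [|v nzv] := @mpoly_nonroot K l (c * c' * lead_coef D * W`_0 * lead_coef FY).
  by rewrite !mulf_neq0 ?lead_coef_eq0.
have sl_nz p : p.@[v] != 0 -> slice idfun i v p != 0 by apply: slice_neq0.
move: nzv; rewrite !mevalM !mulf_eq0 !negb_or -!andbA.
move=> /and5P[/sl_nz cv /sl_nz c'v /sl_nz Dv /sl_nz Wv Fv].
pose psi := slice idfun i v F'.
have psiE t : map_poly (meval (upd v i t)) FY = psi.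
  rewrite map_slice; apply: eq_mmap => a /=; first by rewrite mevalC.
  by rewrite /upd; case: eqP => // ne; rewrite /= mevalXU; case: eqP.
have nzpsi : psi != 0.
  rewrite -(psiE (v i)) -lead_coef_eq0 lead_coef_map_eq.
    by apply: contra_neq Fv => <-; apply: meval_eq => j; rewrite /upd; case: eqP => // ->.
  by apply: contra_neq Fv => <-; apply: meval_eq => j; rewrite /upd; case: eqP => // ->.
have [rs ers] := closed_field_poly_normal psi.
(* Values of the i-th parameter at which some root r <> 0 is a common root. *)
pose Q : {poly K} := \prod_(r <- rs | r != 0)
   ((map_poly (meval (upd v i 0)) W).[r]%:P + r ^+ b *: 'X).
have nzQ : Q != 0.
  rewrite prodf_seq_neq0; apply/allP => r _; apply/implyP => nzr.
  apply: contra_neq (expf_neq0 b nzr) => /(congr1 (fun p : {poly K} => p`_1)).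
  by rewrite coefD coefC coefZ coefX mulr1 add0r coef0.
have /closed_nonrootP[t] : slice idfun i v c * slice idfun i v c' * slice idfun i v (lead_coef D) *
    slice idfun i v W`_0 * Q != 0 by rewrite !mulf_neq0.
rewrite rootE !hornerM !horner_slice !mulf_eq0 !negb_or -!andbA => /and5P[ct c't Dt Wt Qt].
have /closed_rootP[r] : size (map_poly (meval (upd v i t)) D) != 1%N.
  by rewrite size_map_poly_id0 // gtn_eqF.
rewrite rootE => /eqP Dr.
have Wr : (map_poly (meval (upd v i t)) W).[r] = 0.
  have := congr1 (fun p => (map_poly (meval (upd v i t)) p).[r]) eW.
  rewrite -mul_polyC /= !rmorphM /= !hornerM Dr mulr0 map_polyC hornerC => /eqP.
  by rewrite mulf_eq0 (negbTE ct) => /eqP.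
have psir : psi.[r] = 0.
  rewrite -(psiE t); have := congr1 (fun p => (map_poly (meval (upd v i t)) p).[r]) eF.
  rewrite -mul_polyC /= !rmorphM /= !hornerM Dr mulr0 map_polyC hornerC => /eqP.
  by rewrite mulf_eq0 (negbTE c't) => /eqP.
have [r0|nzr] := eqVneq r 0.
  by move/eqP: Wt; apply; move: Wr; rewrite r0 horner_coef0 coef_map.
move/negP: Qt; apply; rewrite /Q horner_prod; apply/eqP.
have rrs : r \in rs.
  rewrite -root_prod_XsubC; move: psir; rewrite ers hornerZ => /eqP.
  by rewrite mulf_eq0 lead_coef_eq0 (negbTE nzpsi) => /eqP/eqP.
apply/eqP; rewrite prodf_seq_eq0; apply/hasP; exists r => //.
by rewrite nzr /= !hornerE [_ * t]mulrC -hornerXn -hornerZ -hornerD -linW Wr.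
Qed.

(** The i-th parameter of F stands for the base point, and the i-th parameter
    of W for the coefficient that is determined by the base point: W is affine
    in it.  Multiplying F by its i-th variable makes sure that the slice has
    positive degree. *)
Lemma root_transfer (W : {poly R}) (b : nat) (F : R) :
  (1 < size W)%N -> W`_0 != 0 ->
  (forall v t, map_poly (meval (upd v i t)) W =
     map_poly (meval (upd v i 0)) W + t *: 'X^b) ->
  F != 0 ->
  exists2 g : R, g != 0 &
    forall (L : closedFieldType) (f : {rmorphism K -> L}) (v : 'I_l -> L),
      mmap f v g != 0 ->
      exists2 t, (map_poly (mmap f v) W).[t] = 0 & mmap f (upd v i t) F != 0.
Proof.
move=> W_nc nzW0 linW nzF.
have nzres := common_root_avoid nzW0 linW nzF; set FY := slice _ _ _ _ in nzres.
have nzW : W != 0 by rewrite -size_poly_gt0 ltnW.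
exists (resultant W FY * lead_coef W); first by rewrite mulf_neq0 ?lead_coef_eq0.
move=> L f v; rewrite rmorphM mulf_eq0 negb_or => /andP[rv Wv].
have /closed_rootP[t] : size (map_poly (mmap f v) W) != 1%N.
  by rewrite size_map_poly_id0 // gtn_eqF.
rewrite rootE => /eqP Wt; exists t => //.
have FY_nc : (1 < size FY)%N.
  rewrite /FY rmorphM /= [slice _ _ _ 'X_i](_ : _ = 'X); last first.
    by rewrite /slice mmapX mmap1U /upd eqxx.
  by rewrite size_mulX ?ltnS ?size_poly_gt0 //; apply: slice_neq0; rewrite mmap_id_mpoly.
have [[p q] /= _ e] := resultant_in_ideal W_nc FY_nc.
have := congr1 (fun p => (map_poly (mmap f v) p).[t]) e.
rewrite rmorphD !rmorphM /= hornerD !hornerM Wt mulr0 add0r map_polyC hornerC => er.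
apply: contra_neq rv => F0; rewrite /= er map_slice.
rewrite [slice _ _ _ _](_ : _ = slice f i v (F * 'X_i)); last first.
  by apply: eq_mmap => a /=; rewrite ?mmapC // /upd; case: eqP => //= _; rewrite mmapX mmap1U.
by rewrite horner_slice rmorphM /= F0 mul0r mulr0.
Qed.

End RootTransfer.

(** * Members of the family through a base point *)

Definition monXY (T : comNzRingType) (t : T) (i j : nat) : {poly {poly T}} :=
  (t *: 'X^i)%:P * 'X^j.

Section MonXY.
Variable T : comNzRingType.

Lemma coef_monXY (t : T) i j k : (monXY t i j)`_k = (k == j)%:R *: (t *: 'X^i).
Proof. by rewrite /monXY coefCM coefXn mulr_natr scaler_nat. Qed.

Lemma monXY_eval (t x y : T) i j : (monXY t i j).[y%:P].[x] = t * x ^+ i * y ^+ j.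
Proof. by rewrite /monXY hornerM hornerC hornerXn hornerM horner_exp hornerC hornerZ hornerXn. Qed.

Lemma monXY_deriv_eval (t x y : T) i j :
  ((monXY t i j)^`()).[y%:P].[x] * y = t * x ^+ i * y ^+ j *+ j.
Proof.
rewrite /monXY derivM derivC mul0r add0r derivXn hornerM hornerC hornerMn hornerXn.
rewrite hornerM hornerZ hornerXn hornerMn horner_exp hornerC mulrnAr mulrnAl.
by case: j => [|j]; rewrite ?mulr0n //= -!mulrA -exprSr.
Qed.

Lemma monXYD (t u : T) i j : monXY (t + u) i j = monXY t i j + monXY u i j.
Proof. by rewrite /monXY scalerDl rmorphD mulrDl. Qed.

Lemma monXY0 i j : monXY 0 i j = 0 :> {poly {poly T}}.
Proof. by rewrite /monXY scale0r mul0r. Qed.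

Lemma monXYZ (t u : T) i j : monXY (t * u) i j = t%:P%:P * monXY u i j.
Proof. by rewrite /monXY -scalerA -(mul_polyC t) rmorphM mulrA. Qed.

Lemma monXY_at (t x : T) i j :
  map_poly (horner_eval x) (monXY t i j) = (t * x ^+ i) *: 'X^j.
Proof. by rewrite /monXY rmorphM /= map_polyC map_polyXn /= horner_evalE !hornerE mul_polyC. Qed.

End MonXY.

Lemma map_monXY (T S : comNzRingType) (g : {rmorphism T -> S}) t i j :
  map_poly (map_poly g) (monXY t i j) = monXY (g t) i j.
Proof. by rewrite /monXY rmorphM /= map_polyC map_polyXn /= map_polyZ map_polyXn. Qed.

Section BasePencil.
Variables (I : finType) (a b : I -> nat) (s1 : I).

(** The member with coefficients kap that passes through (1, t), multiplied by
    t^(b s1): the coefficient at s1 is eliminated, so kap s1 does not occur. *)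
Definition based_member (T : comNzRingType) (t : T) (kap : I -> T) : {poly {poly T}} :=
  \sum_(s | s != s1) (monXY (kap s * t ^+ b s1) (a s) (b s)
                    - monXY (kap s * t ^+ b s) (a s1) (b s1)).

Lemma map_based (T S : comNzRingType) (g : {rmorphism T -> S}) t kap :
  map_poly (map_poly g) (based_member t kap) = based_member (g t) (g \o kap).
Proof.
rewrite rmorph_sum; apply: eq_bigr => s _.
by rewrite rmorphB /= !map_monXY !rmorphM !rmorphXn.
Qed.

Lemma eq_based (T : comNzRingType) (t : T) kap1 kap2 :
  (forall s, s != s1 -> kap1 s = kap2 s) -> based_member t kap1 = based_member t kap2.
Proof. by move=> e; apply: eq_bigr => s /e ->. Qed.

Variable T : comNzRingType.
Implicit Types (t : T) (kap : I -> T).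

Lemma based_vanish t kap : (based_member t kap).[t%:P].[1] = 0.
Proof.
rewrite !horner_sum big1 // => s _; rewrite hornerD hornerN hornerD hornerN.
by rewrite !monXY_eval !expr1n !mulr1 -!mulrA [X in _ * X]mulrC subrr.
Qed.

(** Multiplication by t avoids negative exponents. *)
Lemma based_deriv t kap : ((based_member t kap)^`()).[t%:P].[1] * t =
  \sum_(s | s != s1) (kap s * ((b s)%:R - (b s1)%:R)) * t ^+ (b s + b s1).
Proof.
rewrite raddf_sum /= !horner_sum mulr_suml; apply: eq_bigr => s _.
rewrite derivB hornerD hornerN hornerD hornerN mulrBl !monXY_deriv_eval !expr1n !mulr1.
rewrite exprD -[X in X - _]mulr_natr -[X in _ - X]mulr_natr.
by move: (t ^+ b s) (t ^+ b s1) (b s)%:R (b s1)%:R (kap s) => x y m n c; ring.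
Qed.

Lemma based_family t kap : \sum_s kap s * t ^+ b s = 0 ->
  based_member t kap = (t ^+ b s1)%:P%:P * \sum_s monXY (kap s) (a s) (b s).
Proof.
rewrite (bigD1 s1) //= => /eqP; rewrite addr_eq0 => /eqP e.
rewrite (bigD1 s1) //= mulrDr -monXYZ [t ^+ _ * kap s1]mulrC e.
rewrite /based_member sumrB mulr_sumr addrC; congr (_ + _).
  rewrite /monXY scaleNr rmorphN mulNr scaler_suml rmorph_sum mulr_suml; congr (- _).
by apply: eq_bigr => s _; rewrite -monXYZ mulrC.
Qed.

Lemma coef_based t kap k : (based_member t kap)`_k =
  \sum_(s | s != s1) ((k == b s)%:R *: ((kap s * t ^+ b s1) *: 'X^(a s))
                    - (k == b s1)%:R *: ((kap s * t ^+ b s) *: 'X^(a s1))).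
Proof. by rewrite coef_sum; apply: eq_bigr => s _; rewrite coefB !coef_monXY. Qed.

Lemma size_based t kap d : (forall s, b s <= d)%N -> (size (based_member t kap) <= d.+1)%N.
Proof.
move=> led; apply/leq_sizeP => k ltk; rewrite coef_based big1 // => s _.
by rewrite !gtn_eqF ?(leq_ltn_trans _ ltk) // !scale0r subr0.
Qed.

Lemma size_coef_based t kap k e : (forall s, a s <= e)%N ->
  (size ((based_member t kap)`_k)%R <= e.+1)%N.
Proof.
move=> lee; rewrite coef_based (leq_trans (size_sum _ _ _)) //.
apply/bigmax_leqP => s _; rewrite (leq_trans (size_polyD _ _)) // geq_max size_polyN.
by rewrite !(leq_trans (size_scale_leq _ _)) // size_polyXn ltnS.
Qed.

Lemma lead_based t kap sd : injective b -> b s1 != b sd ->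
  (based_member t kap)`_(b sd) = (kap sd * t ^+ b s1) *: 'X^(a sd).
Proof.
move=> injb ned; rewrite coef_based (bigD1 sd) /=; last by apply: contra_neq ned => ->.
rewrite eqxx scale1r eq_sym (negbTE ned) scale0r subr0 big1 ?addr0 // => s /andP[_ ne].
by rewrite [b sd == _](inj_eq injb) eq_sym (negbTE ne) !scale0r subr0.
Qed.

End BasePencil.

(** * Coprimality of the two ends of the pencil *)

(** The exponent of x in x^(a s) y^(b s) after the substitution y = z x^(e1 -
    e2), increased by e2 d to keep it nonnegative. *)
Definition slope_exp (I : finType) (a b : I -> nat) (d e1 e2 : nat) (s : I) :=
  (a s + e1 * b s + e2 * (d - b s))%N.

Lemma eq_slope_exp (I : finType) (a b : I -> nat) (d J e1 e2 : nat) (s1 s2 : I) :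
  b s2 = (b s1 + J)%N -> a s1 = (J * e1)%N -> a s2 = (J * e2)%N ->
  (b s2 <= d)%N -> slope_exp a b d e1 e2 s2 = slope_exp a b d e1 e2 s1.
Proof.
rewrite /slope_exp => bs2 as1 as2; rewrite as1 as2 bs2 => le2.
have -> : (d - b s1 = J + (d - (b s1 + J)))%N.
  by rewrite subnDA addnBA ?addKn // leq_subRL ?(leq_trans (leq_addr _ _) le2) // addnC.
rewrite !mulnDr; move: (e2 * (d - _))%N => u.
by rewrite (mulnC J e2) (mulnC J e1) addnAC; lia.
Qed.

Section BasePencilGeneric.
Variables (K : closedFieldType) (I : finType) (a b : I -> nat) (s1 s2 : I).
Hypothesis ne21 : s2 != s1.

Definition indicator (T : comNzRingType) (s2 s : I) : T := (s == s2)%:R.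

(** Moving the coefficient at s2 only, the members through (1, t) form a
    pencil whose second end is the member with coefficients [indicator]. *)
Lemma based_pencil (t : K) (kap : I -> K) :
  pencil (based_member a b s1 t kap) (based_member a b s1 t (indicator K s2)) =
  based_member a b s1 t%:P (fun s => (kap s)%:P + (indicator _ s2 s) * 'X).
Proof.
rewrite /pencil /lift_const !map_based mulr_sumr -big_split; apply: eq_bigr => s _.
rewrite /= mulrBr -!monXYZ addrACA -opprD -!monXYD /indicator !rmorph_nat.
by congr (monXY _ _ _ - monXY _ _ _); ring.
Qed.

Lemma based_indicator (t : K) : based_member a b s1 t (indicator K s2) =
  monXY (t ^+ b s1) (a s2) (b s2) - monXY (t ^+ b s2) (a s1) (b s1).
Proof.
rewrite /based_member (bigD1 s2) //= big1 ?addr0 /indicator ?eqxx ?mul1r //.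
by move=> s /andP[_ /negbTE ->]; rewrite !mul0r !monXY0 subrr.
Qed.

Variables (d J e1 e2 : nat) (s0 st : I).
Hypotheses (injb : injective b) (J_gt0 : (0 < J)%N) (bs2 : b s2 = (b s1 + J)%N).
Hypotheses (as1 : a s1 = (J * e1)%N) (as2 : a s2 = (J * e2)%N).
Hypotheses (led : forall s, (b s <= d)%N) (bs0 : b s0 = 0%N).

Local Notation slope := (slope_exp a b d e1 e2).

Hypothesis off_line : slope st != slope s1.

(** Up to a power of x, the restriction of a member through (1, t) to the
    curve x^e2 y = z x^e1. *)
Definition slope_poly (t : K) (kap : I -> K) (z : K) : {poly K} :=
  \sum_(s | s != s1) ((kap s * t ^+ b s1 * z ^+ b s) *: 'X^(slope s)
                    - (kap s * t ^+ b s * z ^+ b s1) *: 'X^(slope s1)).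

Lemma slope_poly_eval (t x y z : K) (kap : I -> K) :
  x ^+ e2 * y = z * x ^+ e1 ->
  x ^+ (e2 * d) * (map_poly (horner_eval x) (based_member a b s1 t kap)).[y] =
  (slope_poly t kap z).[x].
Proof.
move=> eyz.
have pull s : x ^+ (e2 * d) * (x ^+ a s * y ^+ b s) = z ^+ b s * x ^+ slope s.
  rewrite -{1}(subnK (led s)) mulnDr exprD exprM [x ^+ (e2 * b s)]exprM.
  rewrite /slope_exp !exprD (exprM x e1) (exprM x e2 (d - _)).
  have := congr1 (fun u => u ^+ b s) eyz; rewrite /= !exprMn.
  move: (x ^+ a s) (x ^+ e2 ^+ b s) (y ^+ b s) (z ^+ b s) (x ^+ e1 ^+ b s) (x ^+ e2 ^+ _) => A B C D E F e.
  by rewrite -mulrA [B * (A * C)]mulrCA e; ring.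
rewrite rmorph_sum /= !horner_sum mulr_sumr; apply: eq_bigr => s _.
rewrite rmorphB /= !monXY_at hornerD hornerN !hornerZ !hornerXn hornerD hornerN !hornerZ !hornerXn.
rewrite mulrBr -!mulrA; congr (_ - _).
  by rewrite !mulrA -[RHS]mulrA -pull; ring.
by rewrite !mulrA -[RHS]mulrA -pull; ring.
Qed.

Lemma slope_poly_neq0 (t z : K) (kap : I -> K) : t != 0 ->
  \sum_(s | slope s == slope st) kap s * z ^+ b s != 0 ->
  slope_poly t kap z != 0.
Proof.
move=> nzt; apply: contra_neq => /(congr1 (fun p : {poly K} => p`_(slope st))).
rewrite coef0 coef_sum => e; apply: (mulfI (expf_neq0 (b s1) nzt)).
rewrite mulr0 -[RHS]e mulr_sumr big_mkcond [RHS]big_mkcond; apply: eq_bigr => s _ /=.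
rewrite coefB !coefZ !coefXn [slope st == slope s1](negbTE off_line) mulr0 subr0.
have [->|_] := eqVneq s s1; first by rewrite eq_sym (negbTE off_line).
by rewrite eq_sym; case: eqP => _; rewrite ?mulr1 ?mulr0 //; ring.
Qed.

(** The roots y <> 0 of the end [based_member t indicator] are those with x^e2
    y = z x^e1 and z^J = t^J.  Along each of these finitely many curves the
    other end is a nonzero polynomial in x: its terms of exponent slope_exp st
    add up to a nonzero multiple of the sum in the hypothesis.  The root y = 0
    occurs only if b s1 > 0, and then the term at s0 does not vanish. *)
Lemma based_coprime (t : K) (kap : I -> K) :
  t != 0 -> (forall s, s != s1 -> s != s2 -> kap s != 0) ->
  (forall z, z ^+ J = t ^+ J ->
     \sum_(s | slope s == slope st) kap s * z ^+ b s != 0) ->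
  generic_coprime (based_member a b s1 t kap) (based_member a b s1 t (indicator K s2)).
Proof.
move=> nzt nzk nzslope.
have [rs ers] := closed_field_poly_normal ('X^J - (t ^+ J)%:P).
have lcJ : lead_coef ('X^J - (t ^+ J)%:P) = 1 by rewrite lead_coefDl ?lead_coefXn // size_polyXn size_polyN size_polyC expf_neq0 // ltnS.
rewrite lcJ scale1r in ers.
have rsP z : (z \in rs) = (z ^+ J == t ^+ J).
  by rewrite -root_prod_XsubC -ers rootE !hornerE subr_eq0.
exists ('X * \prod_(z <- rs) slope_poly t kap z).
  rewrite mulf_neq0 ?polyX_eq0 // prodf_seq_neq0; apply/allP => z.
  by rewrite rsP => /eqP/nzslope/(slope_poly_neq0 nzt).
move=> x; rewrite hornerM hornerX mulf_eq0 negb_or => /andP[nzx nzP].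
have nzPz z : z ^+ J = t ^+ J -> (slope_poly t kap z).[x] != 0.
  move=> ez; apply: contra_neq nzP => P0; apply/eqP.
  rewrite horner_prod prodf_seq_eq0; apply/hasP; exists z; first by rewrite rsP ez.
  by rewrite P0 eqxx.
rewrite based_indicator rmorphB /= !monXY_at; set c1 := _ - _.
split; last first.
  rewrite ltnNge; apply/negP => /leq_sizeP/(_ (b s2)).
  rewrite bs2 addn_gt0 J_gt0 orbT => /(_ isT).
  rewrite coefB !coefZ !coefXn -bs2 eqxx (inj_eq injb) (negbTE ne21) mulr0 subr0 mulr1.
  by move/eqP; rewrite mulf_eq0 !expf_eq0 (negbTE nzt) (negbTE nzx) !andbF.
apply/Pdiv.ClosedField.root_coprimep => y; apply: contraTN.
rewrite !rootE /c1 hornerD hornerN !hornerZ !hornerXn => /eqP e.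
have [y0|nzy] := eqVneq y 0.
  have b1_gt0 : (0 < b s1)%N.
    rewrite lt0n; apply: contra_eqN e => /eqP b10.
    rewrite y0 b10 bs2 b10 add0n !expr0n eqn0Ngt J_gt0 /= mulr0 sub0r mulr1 oppr_eq0.
    by rewrite mulf_eq0 !expf_eq0 (negbTE nzt) (negbTE nzx) !andbF.
  rewrite y0 -horner_evalE.
  have ne01 : s0 != s1 by apply: contraTneq b1_gt0 => <-; rewrite bs0.
  have ne02 : s0 != s2 by apply: contraTneq (isT) => e0; move: bs2; rewrite -e0 bs0; lia.
  rewrite horner_evalE horner_coef0 coef_map -bs0 lead_based //; last by rewrite (inj_eq injb) eq_sym.
  rewrite /= horner_evalE hornerZ hornerXn !mulf_neq0 ?expf_neq0 ?nzk //.
pose z := x ^+ e2 * y / x ^+ e1.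
have nzx1 : x ^+ e1 != 0 by rewrite expf_neq0.
have ez : x ^+ e2 * y = z * x ^+ e1 by rewrite /z divfK.
suff /nzPz : z ^+ J = t ^+ J.
  rewrite -(slope_poly_eval _ _ ez); apply: contra_neq => ->; exact: mulr0.
apply: (mulIf (expf_neq0 J nzx1)); rewrite -exprMn -ez exprMn -!exprM.
apply: (mulfI (expf_neq0 (b s1) nzt)); apply: (mulIf (expf_neq0 (b s1) nzy)).
move/eqP: e; rewrite subr_eq0 as1 as2 bs2 !exprD (mulnC J) (mulnC J e1) => /eqP e.
move: e; move: (t ^+ b s1) (t ^+ J) (x ^+ (e2 * J)) (x ^+ (e1 * J)) (y ^+ b s1) (y ^+ J).
move=> A B C D E F e; transitivity (A * C * (E * F)); first by ring.
by rewrite e; ring.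
Qed.

End BasePencilGeneric.

(** * Coefficients of the family *)

Section Bivariate.
Variables (K : closedFieldType) (l : nat) (I : finType).
Variables (a b : I -> nat) (c : I -> K) (pt : 'I_l -> I).
Local Notation R := {mpoly K[l]}.

(** A monomial of P may coincide with one of the Q_i, and then its coefficient
    has both parts. *)
Definition coef_at (T : comNzRingType) (f : K -> T) (v : 'I_l -> T) (s : I) : T :=
  f (c s) + \sum_(i | pt i == s) v i.

Definition family_poly (T : comNzRingType) (f : K -> T) (v : 'I_l -> T) : {poly {poly T}} :=
  \sum_s monXY (coef_at f v s) (a s) (b s).

Lemma map_coef_at (T S : comNzRingType) (f : K -> T) (g : {rmorphism T -> S}) v s :
  g (coef_at f v s) = coef_at (g \o f) (g \o v) s.
Proof. by rewrite /coef_at rmorphD rmorph_sum. Qed.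


Lemma coef_at_upd (T : comNzRingType) (f : K -> T) v i t s :
  coef_at f (upd v i t) s = coef_at f (upd v i 0) s + (s == pt i)%:R * t.
Proof.
rewrite /coef_at -addrA; congr (_ + _).
have [->|ne] := eqVneq s (pt i).
  rewrite (bigD1 i) //= [X in _ = X + _](bigD1 i) //= /upd eqxx mul1r add0r addrC; congr (_ + _).
  by apply: eq_bigr => j /andP[_ /negbTE ->].
rewrite mul0r addr0; apply: eq_bigr => j /eqP e.
by rewrite /upd; case: eqP => // e'; rewrite -e e' eqxx in ne.
Qed.

Lemma coef_at_upd_ne (T : comNzRingType) (f : K -> T) v i t s : s != pt i ->
  coef_at f (upd v i t) s = coef_at f v s.
Proof.
move=> ne; rewrite /coef_at; congr (_ + _); apply: eq_bigr => j /eqP e.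
by rewrite /upd; case: eqP => // e'; rewrite -e e' eqxx in ne.
Qed.

Definition gen_coef : I -> R := coef_at (@mpolyC l K) (fun i => 'X_i).

Lemma eval_gen_coef (T : comNzRingType) (f : {rmorphism K -> T}) v s :
  mmap f v (gen_coef s) = coef_at f v s.
Proof.
rewrite map_coef_at /coef_at /= mmapC; congr (_ + _).
by apply: eq_bigr => i _; rewrite /= mmapX mmap1U.
Qed.

Hypothesis gen_coef_neq0 : forall s, gen_coef s != 0.

Variable i1 : 'I_l.
Local Notation s1 := (pt i1).

Lemma map_based_gen (T : comNzRingType) (f : {rmorphism K -> T}) w :
  map_poly (map_poly (mmap f w)) (based_member a b s1 'X_i1 gen_coef) =
  based_member a b s1 (w i1) (coef_at f w).
Proof.
rewrite map_based /= mmapX mmap1U; apply: eq_based => s _ /=.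
exact: eval_gen_coef.
Qed.

(** The y-derivative at the base point (1, t) of the general member through
    this point; the parameter i1 plays the role of t. *)
Definition slope_deriv : R := ((based_member a b s1 'X_i1 gen_coef)^`()).[('X_i1)%:P].[1].

Hypothesis b_inj : injective b.

Lemma slice_gen_coef (i : 'I_l) (v : 'I_l -> K) s :
  slice idfun i v (gen_coef s) =
  (coef_at idfun (upd v i 0) s)%:P + (s == pt i)%:R * 'X.
Proof.
rewrite /slice eval_gen_coef coef_at_upd; congr (_ + _).
rewrite (map_coef_at _ polyC) /coef_at; congr (_ + _); apply: eq_bigr => j _ /=.
by rewrite /upd; case: eqP.
Qed.

Lemma slope_deriv_neq0 : (exists s, (b s)%:R != (b s1)%:R :> K) -> slope_deriv != 0.
Proof.
move=> [s ne]; have [v nzv] := mpoly_nonroot (gen_coef_neq0 s).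
have nes : s != s1 by apply: contra_neq ne => ->.
apply: contra_neq nzv => d0.
have := congr1 (slice idfun i1 v) (based_deriv a b s1 'X_i1 gen_coef).
rewrite -/slope_deriv d0 mul0r raddf0 rmorph_sum => /esym.
rewrite [LHS](_ : _ = \sum_(s <- [seq s <- index_enum I | s != s1])
   (coef_at idfun v s * ((b s)%:R - (b s1)%:R)) *: 'X^(b s + b s1)); last first.
  rewrite big_filter; apply: eq_bigr => r ner.
  rewrite rmorphM rmorphM rmorphXn rmorphB /= !rmorph_nat slice_gen_coef.
  rewrite (negbTE ner) mul0r addr0 coef_at_upd_ne // [slice _ _ _ 'X_i1](_ : _ = 'X).
    by rewrite -[in RHS]mul_polyC rmorphM rmorphB /= !rmorph_nat.
  by rewrite /slice mmapX mmap1U /upd eqxx.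
move=> /(congr1 (fun p : {poly K} => p`_(b s + b s1))).
rewrite (@coef_sum_monomials _ _ _ _ (fun s => b s + b s1)%N).
- rewrite coef0 => /eqP; rewrite mulf_eq0 subr_eq0 (negbTE ne) orbF => /eqP e.
  by rewrite -[LHS]/(mmap idfun v _) (eval_gen_coef idfun).
- by rewrite filter_uniq // index_enum_uniq.
- by move=> x y _ _ /addIn/b_inj.
- by rewrite mem_filter nes mem_index_enum.
Qed.

End Bivariate.

(** * Irreducibility in two variables *)

Section BivariateTheorem.
Variables (K : closedFieldType) (l : nat) (I : finType).
Variables (a b : I -> nat) (c : I -> K) (pt : 'I_l -> I).
Local Notation R := {mpoly K[l]}.
Local Notation coef_at := (coef_at c pt).
Local Notation gen_coef := (gen_coef c pt).

Hypothesis gen_coef_neq0 : forall s, gen_coef s != 0.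
Hypothesis b_inj : injective b.

Variables (i1 i2 : 'I_l).
Local Notation s1 := (pt i1).
Local Notation s2 := (pt i2).

Variables (J e1 e2 : nat) (s0 sd st : I).
Hypotheses (J_gt0 : (0 < J)%N) (bs2 : b s2 = (b s1 + J)%N).
Hypotheses (as1 : a s1 = (J * e1)%N) (as2 : a s2 = (J * e2)%N).
Hypotheses (b_max : forall s, (b s <= b sd)%N) (bs0 : b s0 = 0%N).
Hypothesis off_line : (a st + e1 * b st + e2 * b s1 != a s1 + e1 * b s1 + e2 * b st)%N.
Hypothesis separable_dir : exists s, (b s)%:R != (b s1)%:R :> K.

Let ne12 : s2 != s1.
Proof. by apply/negP => /eqP e; move: bs2; rewrite e; lia. Qed.

Let slope := slope_exp a b (b sd) e1 e2.

Let off_slope : slope st != slope s1.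
Proof.
have := b_max st; have := b_max s1; rewrite /slope /slope_exp => l1 l2.
apply: contra_neq off_line => e.
have h (m : nat) : (m <= b sd)%N -> (e2 * (b sd - m) + e2 * m = e2 * b sd)%N.
  by move=> le; rewrite -mulnDr subnK.
have := h _ l1; have := h _ l2; lia.
Qed.

Lemma slope_class_ne s : slope s == slope st -> s != s1 /\ s != s2.
Proof.
move=> /eqP e; split; apply: contraNneq off_slope => es; rewrite -e es //.
by rewrite /slope (eq_slope_exp bs2 as1 as2).
Qed.

(** The sum in the last clause does not involve the parameter i1, whose value
    is chosen last, outside the finitely many t with t^J = r^J for a root r of
    this sum. *)
Lemma good_point : exists v : 'I_l -> K,
  [/\ v i1 != 0, forall s, coef_at idfun v s != 0,
      (slope_deriv a b c pt i1).@[v] != 0 &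
      forall z, z ^+ J = v i1 ^+ J ->
       \sum_(s | slope s == slope st) coef_at idfun (upd v i2 0) s * z ^+ b s != 0].
Proof.
have nzX : 'X_i1 != 0 :> R by rewrite -msize_poly_eq0 msizeX.
(* All conditions other than the last one are open. *)
pose P : R := 'X_i1 * \prod_s gen_coef s * slope_deriv a b c pt i1.
have [|v nzPv] := @mpoly_nonroot K l P.
  by rewrite !mulf_neq0 ?slope_deriv_neq0 //; apply/prodf_neq0.
pose H : {poly K} := \sum_(s <- [seq s <- index_enum I | slope s == slope st])
   coef_at idfun (upd v i2 0) s *: 'X^(b s).
have gen_nz u : P.@[u] != 0 -> forall s, coef_at idfun u s != 0.
  rewrite !mevalM !mulf_eq0 !negb_or -andbA => /and3P[_ nz _] s.
  rewrite -(eval_gen_coef c pt idfun); move: nz; rewrite -[meval _ _]/(mmap idfun u _) rmorph_prod.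
  by move/prodf_neq0 => /(_ s isT).
have nzH : H != 0.
  apply: contra_neq (gen_nz _ nzPv st) => /(congr1 (fun p : {poly K} => p`_(b st))).
  rewrite coef_sum_monomials ?filter_uniq ?index_enum_uniq //.
  - rewrite coef0 coef_at_upd_ne // => //.
    by have [] := slope_class_ne (eqxx (slope st)).
  - by move=> x y _ _ /b_inj.
  - by rewrite mem_filter eqxx mem_index_enum.
have [rs ers] := closed_field_poly_normal H.
(* Values of t for which some z with z^J = t^J is a root of H. *)
pose Q : {poly K} := \prod_(r <- rs) ('X^J - (r ^+ J)%:P).
have nzQ : Q != 0.
  rewrite prodf_seq_neq0; apply/allP => r _ /=.
  by rewrite -lead_coef_eq0 lead_coefDl ?lead_coefXn ?oner_eq0 // size_polyXn size_polyN size_polyC (leq_ltn_trans (leq_b1 _)).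
have /closed_nonrootP[t] : slice idfun i1 v P * Q != 0.
  by rewrite mulf_neq0 // slice_neq0.
rewrite rootE hornerM mulf_eq0 negb_or horner_slice => /andP[Pt Qt].
exists (upd v i1 t); split.
- move: Pt; rewrite rmorphM rmorphM /= !mulf_eq0 !negb_or -andbA => /and3P[+ _ _].
  by rewrite mmapX mmap1U.
- exact: gen_nz.
- by move: Pt; rewrite rmorphM mulf_eq0 negb_or => /andP[].
move=> z; rewrite {1}/upd eqxx => ez; apply: contra_neq Qt => e.
have Hz : H.[z] = 0.
  rewrite -[RHS]e horner_sum big_filter; apply: eq_bigr => s es.
  have [n1 n2] := slope_class_ne es.
  by rewrite hornerZ hornerXn !coef_at_upd_ne.
have zrs : z \in rs.
  rewrite -root_prod_XsubC; move/eqP: Hz; rewrite ers hornerZ.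
  by rewrite mulf_eq0 lead_coef_eq0 (negbTE nzH).
apply/eqP; rewrite horner_prod prodf_seq_eq0; apply/hasP; exists z => //=.
by rewrite !hornerE ez subrr.
Qed.

Local Notation genG := (based_member a b s1 'X_i1 gen_coef : {poly {poly R}}).
Local Notation del := (slope_deriv a b c pt i1).

Let e := \max_s a s.
Let d := b sd.
Let N := ((d + d) * e).+1.

Let d_gt : (b s1 < d)%N.
Proof. by apply: leq_trans (b_max s2); rewrite bs2; lia. Qed.

(** The minor is found after all parameters other than i2 are replaced by the
    coordinates of a good point; a minor that is nonzero after this
    specialization is nonzero. *)
Lemma kernel_minor (y q : {poly R}) :
  arc_eval (1 + del ^+ 2 *: 'X) y genG = 'X^N * q ->
  exists h : 'I_(d * e.+1) -> 'I_N,
    \det (colsub h (arc_mx d e.+1 N (1 + del ^+ 2 *: 'X) y)) != 0.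
Proof.
move=> arcG; have [v [nzt nzk nzd nzs]] := good_point.
pose sl : {rmorphism R -> {poly K}} := slice idfun i2 v.
have a_le s : (a s <= e)%N by rewrite /e; apply: leq_bigmax.
pose kap := coef_at idfun (upd v i2 0).
have mapG : map_poly (map_poly sl) genG =
    pencil (based_member a b s1 (v i1) kap) (based_member a b s1 (v i1) (indicator K s2)).
  rewrite (based_pencil a b s1 s2 (v i1) kap) map_based.
  have -> : sl 'X_i1 = (v i1)%:P.
    rewrite /sl /= /slice mmapX mmap1U /upd ifN //.
    by apply: contraNneq ne12 => ->.
  by apply: eq_based => s _; rewrite /= slice_gen_coef.
have nzdel : sl del ^+ 2 != 0 by rewrite expf_neq0 // slice_neq0.
have cop : generic_coprime (based_member a b s1 (v i1) kap) (based_member a b s1 (v i1) (indicator K s2)).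
  apply: (@based_coprime _ _ _ _ _ _ ne12 _ J e1 e2 s0 st) => //.
  by move=> s n1 n2; rewrite /kap coef_at_upd_ne.
have mapx : map_poly sl (1 + del ^+ 2 *: 'X) = 1 + sl del ^+ 2 *: 'X.
  by rewrite rmorphD rmorph1 /= map_polyZ map_polyX rmorphXn.
have arcP : arc_eval (1 + sl del ^+ 2 *: 'X) (map_poly sl y)
    (pencil (based_member a b s1 (v i1) kap) (based_member a b s1 (v i1) (indicator K s2))) =
    'X^N * map_poly sl q.
  by rewrite -mapG -mapx -map_arc_eval arcG rmorphM /= map_polyXn.
have sP : size (pencil (based_member a b s1 (v i1) kap) (based_member a b s1 (v i1) (indicator K s2))) = d.+1.
  rewrite (based_pencil a b s1 s2 (v i1) kap); apply/eqP; rewrite eqn_leq size_based //=.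
  rewrite ltnNge; apply/negP => /leq_sizeP/(_ d (leqnn _)).
  rewrite lead_based // ?neq_ltn ?d_gt //; apply/eqP.
  rewrite -mul_polyC mulf_eq0 polyC_eq0 (negbTE (monic_neq0 (monicXn _ _))) orbF mulf_neq0 //; last first.
    by rewrite expf_neq0 // polyC_eq0.
  rewrite /kap -slice_gen_coef; apply: slice_neq0.
  by rewrite (eval_gen_coef c pt idfun).
have [|h nzh] := minor_of_trivial_kernel
  (M := arc_mx d e.+1 N (1 + sl del ^+ 2 *: 'X) (map_poly sl y)).
  apply: arc_mx_kernel => A r sA eA arcA.
  apply: (arc_kernel_trivial nzdel cop _ sP _ _ arcP sA eA arcA) => //.
  - exact: leq_ltn_trans d_gt.
  - by move=> i; rewrite (based_pencil a b s1 s2 (v i1) kap) size_coef_based.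
exists h; apply: contra_neq nzh => D0; rewrite -[RHS](rmorph0 sl) -D0 -det_map_mx.
rewrite -mapx -map_arc_mx; congr (\det _).
by apply/matrixP => i j; rewrite !mxE.
Qed.

(** Irreducibility up to factors without y.  The hypotheses say: J, e1 and e2
    describe the ratio of the two moving monomials as a J-th power; s0 and sd
    carry the least and the largest exponent of y; st is off the line through
    s1 and s2; and some exponent of y is separated from the one of s1 in K. *)
Lemma family_irreducible : exists2 g : R, g != 0 &
  forall (L : closedFieldType) (f : {rmorphism K -> L}) (v : 'I_l -> L),
    mmap f v g != 0 ->
    forall A B, family_poly a b c pt f v = A * B -> (size A <= 1)%N \/ (size B <= 1)%N.
Proof.
have [y [y0 [q arcG]]] := hensel_arc (based_vanish a b s1 'X_i1 gen_coef) N.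
have [h nzF] := kernel_minor arcG; set F := \det _ in nzF.
have nzdel : del != 0 by apply: slope_deriv_neq0.
pose W : {poly R} := \sum_s gen_coef s *: 'X^(b s).
have coefW s : W`_(b s) = gen_coef s.
  by rewrite /W coef_sum_monomials ?index_enum_uniq ?mem_index_enum // => x z _ _ /b_inj.
have mapW (T : comNzRingType) (f : {rmorphism K -> T}) w :
    map_poly (mmap f w) W = \sum_s coef_at f w s *: 'X^(b s).
  rewrite rmorph_sum; apply: eq_bigr => s _.
  rewrite /= map_polyZ map_polyXn. congr (_ *: _); exact: (eval_gen_coef c pt f).
have [||v t||g nzg gP] := @root_transfer K l i1 W (b s1) (F * del).
- rewrite ltnNge; apply/negP => /leq_sizeP/(_ d); rewrite coefW.
  by move=> /(_ (leq_ltn_trans (leq0n _) d_gt)) /eqP; apply/negP/gen_coef_neq0.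
- by rewrite -bs0 coefW.
- rewrite -[meval _]/(mmap idfun _) -[meval (upd v i1 0)]/(mmap idfun _) !mapW.
  rewrite (bigD1 s1) // [in RHS](bigD1 s1) //= [in LHS]coef_at_upd // eqxx mul1r scalerDl.
  rewrite -!addrA [t *: _ + _]addrC addrA addrA; congr (_ + _ + _).
  by apply: eq_bigr => s ne; rewrite coef_at_upd // (negbTE ne) mul0r addr0.
- by rewrite mulf_neq0.
exists g => // L f v /gP[t Wt]; set w := upd v i1 t; rewrite rmorphM mulf_eq0 negb_or.
move=> /andP[Fw delw] A B eAB.
have wt : w i1 = t by rewrite /w /upd eqxx.
have Gw : based_member a b s1 t (coef_at f w) = (t ^+ b s1)%:P%:P * (A * B).
  rewrite -eAB -based_family.
    by apply: eq_based => s ne; rewrite coef_at_upd_ne.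
  rewrite -[RHS]Wt mapW horner_sum; apply: eq_bigr => s _.
  by rewrite hornerZ hornerXn.
pose phi : {rmorphism R -> L} := mmap f w.
have phiG : map_poly (map_poly phi) genG = based_member a b s1 t (coef_at f w).
  by rewrite -[in RHS]wt; exact: map_based_gen.
have phidel : phi del != 0 by exact: delw.
have delE : phi del = ((based_member a b s1 t (coef_at f w))^`()).[t%:P].[1].
  rewrite -phiG deriv_map /slope_deriv.
  have -> : t%:P = map_poly phi ('X_i1)%:P.
    by rewrite map_polyC /= mmapX mmap1U wt.
  by rewrite -(rmorph1 phi) !horner_map.
pose x' := 1 + phi del ^+ 2 *: 'X : {poly L}; pose y' := map_poly phi y.
have mapx : map_poly phi (1 + del ^+ 2 *: 'X) = x'.
  by rewrite rmorphD rmorph1 /= map_polyZ map_polyX rmorphXn.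
have arcL : arc_eval x' y' (based_member a b s1 t (coef_at f w)) = 'X^N * map_poly phi q.
  by rewrite -phiG -mapx -map_arc_eval arcG rmorphM /= map_polyXn.
have nzdet : \det (colsub h (arc_mx d e.+1 N x' y')) != 0.
  apply: contra_neq Fw => D0; rewrite -[RHS]D0 -mapx -map_arc_mx /F -det_map_mx.
  by congr (\det _); apply/matrixP => i j; rewrite !mxE.
have nzAB : A * B != 0.
  apply: contra_neq phidel => AB0; rewrite delE Gw AB0 mulr0.
  by rewrite deriv0 !horner0.
have sAB : (size (A * B)%R <= d.+1)%N.
  rewrite -eAB (leq_trans (size_sum _ _ _)) //; apply/bigmax_leqP => s _.
  by apply/leq_sizeP => k ltk; rewrite coef_monXY gtn_eqF ?scale0r // (leq_ltn_trans (b_max s)).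
have sYAB : (sizeY (A * B)%R <= e.+1)%N.
  rewrite -eAB; apply/bigmax_leqP => k _.
  rewrite coef_sum (leq_trans (size_sum _ _ _)) //; apply/bigmax_leqP => s _.
  rewrite coef_monXY !(leq_trans (size_scale_leq _ _)) // size_polyXn ltnS.
  exact: leq_bigmax.
(* C vanishes at the base point and is too small in y unless D is free of y. *)
have half C D : A * B = C * D -> C.[t%:P].[1] = 0 -> (size D <= 1)%N.
  move=> eCD C0; rewrite leqNgt; apply/negP => D_nc.
  have [nzC nzD] : C != 0 /\ D != 0 by apply/andP; rewrite -negb_or -mulf_eq0 -eCD.
  move: (phidel); rewrite delE Gw eCD.
  rewrite derivM derivC mul0r add0r derivM !hornerM !hornerD !hornerM C0 !hornerC mul0r addr0.
  rewrite !mulf_eq0 !negb_or => /and3P[nztb _ D1].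
  have [r arcC] : exists r, arc_eval x' y' C = 'X^N * r.
    apply: (@Xn_dvd_cancel _ _ _ ((t ^+ b s1)%:P * arc_eval x' y' D) (map_poly phi q)).
      rewrite hornerM hornerC mulf_neq0 // arc_eval_const.
      rewrite /y' -{1}(rmorph0 phi) horner_map y0 /= mmapX mmap1U wt.
      by rewrite /x' hornerD hornerC hornerZ hornerX mulr0 addr0.
    rewrite -arcL Gw eCD !arc_evalM arc_evalC comp_polyC; ring.
  have : C = 0; last by move/eqP; rewrite (negbTE nzC).
  apply: arc_mx_inj0 nzdet _ _ arcC.
    move: sAB; rewrite eCD size_mul //; move: D_nc; case: (size D) => [|[|k]] // _.
    by rewrite !addnS /= ltnS; apply: leq_trans; exact: leq_addr.
  move=> i; apply: leq_trans (max_size_coefXY _ _) _.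
  apply: leq_trans sYAB; rewrite eCD !sizeYE rmorphM /= size_mul ?swapXY_eq0 //.
  have : (0 < size (swapXY D))%N by rewrite size_poly_gt0 swapXY_eq0.
  by case: (size (swapXY D)) => // k _; rewrite addnS /= leq_addr.
have : (based_member a b s1 t (coef_at f w)).[t%:P].[1] = 0 by apply: based_vanish.
rewrite Gw !hornerM !hornerC => /eqP; rewrite !mulf_eq0 => /or3P[/eqP t0|/eqP A0|/eqP B0].
- move: phidel; rewrite delE Gw t0 polyC0 mul0r.
  by rewrite deriv0 !horner0 eqxx.
- by right; apply: (half A B).
- by left; apply: (half B A) => //; rewrite mulrC.
Qed.

End BivariateTheorem.

(** * Separating exponents by weights *)

Section Kronecker.
Variable n : nat.

(** Digits in base B, where the j-th coordinate is the digit of units, so that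
    the weight is congruent to it modulo every divisor of B. *)
Definition kron (B : nat) (j : 'I_n) (k : 'I_n) : nat :=
  if k == j then 1%N else (B ^ k.+1)%N.

Lemma kron_inj (B : nat) (j : 'I_n) (m m' : 'X_{1..n}) :
  (forall k, m k < B)%N -> (forall k, m' k < B)%N ->
  weight (kron B j) m = weight (kron B j) m' -> m = m'.
Proof.
move=> ltm ltm' e; have B_gt0 : (0 < B)%N by apply: leq_ltn_trans (ltm j).
pose dig (u : 'X_{1..n}) (k : nat) : nat := if k is k'.+1 then
  (if insub k' is Some i then (if i == j then 0 else u i) else 0)%N else u j.
have dig_lt (u : 'X_{1..n}) : (forall k, u k < B)%N -> forall k, (dig u k < B)%N.
  by move=> ltu [|k] //=; case: insubP => [i _ _|] //; case: eqP.
have digS u (i : 'I_n) : dig u i.+1 = (if i == j then 0 else u i)%N.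
  by rewrite /dig valK.
have sumE u : (\sum_(k < n.+1) B ^ k * dig u k)%N = weight (kron B j) u.
  transitivity (u j + \sum_(k < n) B ^ k.+1 * (if k == j then 0 else u k))%N.
    rewrite big_ord_recl expn0 mul1n; congr (_ + _)%N.
    by apply: eq_bigr => i _; rewrite -digS lift0.
  rewrite /weight (bigD1 j) //= [in RHS](bigD1 j) //= /kron eqxx mul1n muln0 add0n.
  by congr (_ + _)%N; apply: eq_bigr => i /negbTE ->.
have D := digits_inj (dig_lt _ ltm) (dig_lt _ ltm') (n := n.+1).
have {}D k : (k < n.+1)%N -> dig m k = dig m' k by apply: D; rewrite !sumE.
apply/mnmP => i; have := D i.+1; rewrite !digS ltnS => /(_ (ltn_ord i)).
by case: eqP => // -> _; apply: (D 0%N).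
Qed.

Lemma kron_modn (p B : nat) (j : 'I_n) (m : 'X_{1..n}) :
  (weight (kron (p * B) j) m = m j %[mod p])%N.
Proof.
rewrite /weight (bigD1 j) //= {1}/kron eqxx mul1n -[in RHS](addn0 (m j)).
rewrite -modnDmr; congr ((_ + _) %% _)%N; apply/eqP.
apply: (big_ind (fun x => x %% p == 0)%N) => [|x y /eqP dx /eqP dy|i ne]; first by rewrite mod0n.
  by rewrite -modnDm dx dy mod0n.
by rewrite /kron (negbTE ne) expnS -!mulnA modnMr.
Qed.

End Kronecker.

Lemma eqr_nat_pchar (R : idomainType) (p x y : nat) : p \in [pchar R] ->
  (x%:R == y%:R :> R) = (x == y %[mod p]).
Proof.
move=> cp; wlog le : x y / (x <= y)%N => [hw|].
  by case: (leqP x y) => [/hw //|/ltnW/hw]; rewrite eq_sym => ->; rewrite eq_sym.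
by rewrite eq_sym [in RHS]eq_sym eqn_mod_dvd // (dvdn_pcharf cp) natrB // subr_eq0.
Qed.

(** If the weights of m1 and m2 in a large base agree in K, then K has
    positive characteristic p, and taking the base divisible by p makes the
    weight congruent modulo p to a coordinate where the p-th power hypothesis
    gives a difference. *)
Lemma separating_weights (K : idomainType) (n B : nat) (S : seq 'X_{1..n})
    (m1 m2 : 'X_{1..n}) (j0 : 'I_n) :
  m1 \in S -> m2 \in S -> m1 != m2 ->
  (forall m k, m \in S -> (m k < B)%N) ->
  (forall p, p \in [pchar K] ->
     exists m m' (j : 'I_n), [/\ m \in S, m' \in S & m j != m' j %[mod p]]) ->
  exists w : 'I_n -> nat,
    [/\ forall m m' : 'X_{1..n}, (forall k, m k < B)%N -> (forall k, m' k < B)%N ->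
          weight w m = weight w m' -> m = m' &
        exists m m', [/\ m \in S, m' \in S & (weight w m)%:R != (weight w m')%:R :> K]].
Proof.
move=> m1S m2S ne12 ltB sepp; pose w0 := kron B j0.
have [e|ne] := eqVneq ((weight w0 m1)%:R : K) (weight w0 m2)%:R; last first.
  by exists w0; split; [apply: kron_inj | exists m1, m2].
have neN : weight w0 m1 != weight w0 m2.
  by apply: contra_neq ne12; apply: kron_inj => k; apply: ltB.
have [p cp] : exists p, p \in [pchar K].
  move: e neN; move: (weight w0 m1) (weight w0 m2) => x y.
  wlog lt : x y / (x < y)%N.
    by move=> hw e ne; case: (ltngtP x y) ne => // lt _;
      [apply: (hw x y) | apply: (hw y x)]; rewrite // neq_ltn lt ?orbT.
  move=> e _; apply: (@natf0_pchar _ (y - x)); first by rewrite subn_gt0.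
  by rewrite natrB ?(ltnW lt) // e subrr.
have [m [m' [j [mS m'S ne]]]] := sepp _ cp.
have p_gt0 : (0 < p)%N := prime_gt0 (pcharf_prime cp).
exists (kron (p * B) j); split.
  move=> u u' ltu ltu'; have leB : (B <= p * B)%N by rewrite leq_pmull.
  by apply: kron_inj => k; apply: leq_trans leB.
by exists m, m'; split=> //; rewrite (eqr_nat_pchar _ _ cp) !kron_modn.
Qed.

Lemma dvd_mpolyX (K : idomainType) (n : nat) (p : {mpoly K[n]}) (j : 'I_n) :
  (forall m, m \in msupp p -> (0 < m j)%N) -> divides 'X_j p.
Proof.
move=> gt0; exists (\sum_(m <- msupp p) p@_m *: 'X_[m - U_(j)]).
rewrite [LHS]mpolyE mulr_suml big_seq [RHS]big_seq; apply: eq_bigr => m /gt0 mj.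
by rewrite -scalerAl -mpolyXD submK // lep1mP -lt0n.
Qed.

(** K is perfect and the Frobenius map is additive. *)
Lemma pth_power_of_dvd (K : closedFieldType) (n p : nat) (P : {mpoly K[n]}) :
  p \in [pchar K] -> (forall m j, m \in msupp P -> (p %| m j)%N) -> is_pth_power p P.
Proof.
move=> cp dvd_supp; have p_gt0 : (0 < p)%N := prime_gt0 (pcharf_prime cp).
have cpR : p \in [pchar {mpoly K[n]}].
  by rewrite inE (pcharf_prime cp) /= -mpolyC_nat (pcharf0 cp) mpolyC0.
have root_ex (x : K) : exists y, y ^+ p == x.
  have /closed_rootP[y] : size ('X^p - x%:P) != 1%N.
    by rewrite size_XnsubC // eqSS -lt0n.
  by rewrite rootE !hornerE subr_eq0 => e; exists y.
pose rt x := xchoose (root_ex x).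
have rtP x : rt x ^+ p = x by apply/eqP/(xchooseP (root_ex x)).
pose quo (m : 'X_{1..n}) := [multinom (m i %/ p)%N | i < n].
exists (\sum_(m <- msupp P) rt P@_m *: 'X_[quo m]).
rewrite -(pFrobenius_autE cpR) rmorph_sum [LHS]mpolyE big_seq [RHS]big_seq.
apply: eq_bigr => m mP; rewrite /= pFrobenius_autE exprZn rtP mpolyXn; congr (_ *: 'X_[_]).
by apply/mnmP => i; rewrite mulmnE mnmE divnK // dvd_supp.
Qed.

(** * Reduction to two variables *)

Section Substitution.
Variables (n J : nat) (j0 : 'I_n) (w : 'I_n -> nat) (T : idomainType).

Definition monomial_subst : {rmorphism {mpoly T[n]} -> {poly {poly T}}} :=
  mmap (polyC \o polyC) (fun j => monXY 1 (J * (j == j0)) (w j)).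

Lemma monomial_substX c m : monomial_subst (c *: 'X_[m]) = monXY c (J * m j0) (weight w m).
Proof.
rewrite /monomial_subst /= mmapZ mmapX /= -[c in RHS]mulr1 monXYZ; congr (_ * _).
have monM (i1 i2 k1 k2 : nat) :
    monXY 1 i1 k1 * monXY 1 i2 k2 = monXY 1 (i1 + i2) (k1 + k2) :> {poly {poly T}}.
  by rewrite /monXY !scale1r mulrACA -rmorphM -!exprD.
have monX (i k e : nat) : monXY 1 i k ^+ e = monXY 1 (i * e) (k * e) :> {poly {poly T}}.
  elim: e => [|e IH]; last by rewrite exprS IH monM !mulnS.
  by rewrite expr0 !muln0 /monXY scale1r !expr0 mulr1.
rewrite /mmap1 /weight; under eq_bigr do rewrite monX.
transitivity (monXY 1 (\sum_i J * (i == j0) * m i) (\sum_i w i * m i) : {poly {poly T}}).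
  elim/big_ind3: _ => //; first by rewrite /monXY scale1r !expr0 mulr1.
  by move=> x1 x2 y1 y2 z1 z2 -> ->; rewrite monM.
congr (monXY _ _ _); rewrite (bigD1 j0) //= eqxx muln1 big1 ?addn0 // => i /negbTE ->.
by rewrite muln0 mul0n.
Qed.

Lemma monomial_substE A : monomial_subst A = \sum_(m <- msupp A) monXY A@_m (J * m j0) (weight w m).
Proof. by rewrite {1}[A]mpolyE rmorph_sum; apply: eq_bigr => m _; exact: monomial_substX. Qed.

Variable B : nat.
Hypothesis w_inj : forall m m' : 'X_{1..n},
  (forall k, m k < B)%N -> (forall k, m' k < B)%N -> weight w m = weight w m' -> m = m'.

Lemma coef_subst A m : (msize A <= B)%N -> m \in msupp A ->
  (monomial_subst A)`_(weight w m) = A@_m *: 'X^(J * m j0).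
Proof.
move=> leB mA; rewrite monomial_substE coef_sum (bigD1_seq m) ?msupp_uniq //=.
rewrite coef_monXY eqxx scale1r big_seq_cond big1 ?addr0 // => m' /andP[m'A ne].
rewrite coef_monXY; case: eqP => [e|_]; last by rewrite scale0r.
by case/eqP: ne; apply/esym/w_inj => // k; apply: leq_trans leB; apply: mnm_lt_msize.
Qed.

Lemma subst_neq0 A : (msize A <= B)%N -> A != 0 -> monomial_subst A != 0.
Proof.
move=> leB nzA; have mA := mlead_supp nzA.
apply: contraTneq (mA) => s0; have := coef_subst leB mA; rewrite s0 coef0 => /esym/eqP.
by rewrite -mul_polyC mulf_eq0 polyC_eq0 (negbTE (monic_neq0 (monicXn _ _))) orbF
  mcoeff_msupp negbK.
Qed.

Lemma subst_monomial A (p : {poly T}) s : (msize A <= B)%N -> A != 0 ->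
  monomial_subst A = p%:P * 'X^s -> exists m c, A = c *: 'X_[m].
Proof.
move=> leB nzA e.
have wt m : m \in msupp A -> weight w m = s.
  move=> mA; have := coef_subst leB mA; rewrite e coefCM coefXn.
  case: eqP => // _; rewrite mulr0 => /esym/eqP.
  rewrite -mul_polyC mulf_eq0 polyC_eq0 (negbTE (monic_neq0 (monicXn _ _))) orbF.
  by rewrite mcoeff_eq0 mA.
have mA := mlead_supp nzA; exists (mlead A), A@_(mlead A).
rewrite [LHS]mpolyE (bigD1_seq (mlead A)) ?msupp_uniq //= big_seq_cond big1 ?addr0 //.
move=> m /andP[m'A /eqP[]]; apply: w_inj; last by rewrite !wt.
  by move=> k; apply: leq_trans leB; apply: mnm_lt_msize.
by move=> k; apply: leq_trans leB; apply: mnm_lt_msize.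
Qed.

End Substitution.

Lemma strip_Xn (T : idomainType) (p : {poly T}) : p != 0 ->
  exists q s, p = q * 'X^s /\ q`_0 != 0.
Proof.
move=> nzp; have [s [q]] := multiplicity_XsubC p 0; rewrite nzp /= polyC0 subr0.
by rewrite rootE horner_coef0 => nzq e; exists q, s.
Qed.

Lemma strip_Xn_uniq (T : idomainType) (p q : {poly T}) s t :
  p`_0 != 0 -> q`_0 != 0 -> p * 'X^s = q * 'X^t -> p = q.
Proof.
move=> p0 q0 e.
suff est : s = t by apply: (mulIf (monic_neq0 (monicXn T s))); rewrite e est.
wlog lt : p q s t p0 q0 e / (s < t)%N.
  by move=> hw; case: (ltngtP s t) => // lt; [apply: (hw p q) | apply/esym/(hw q p)].
have := congr1 (fun r : {poly T} => r`_s) e.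
by rewrite !coefMXn ltnn subnn lt => e0; rewrite e0 eqxx in p0.
Qed.

(** For each variable, F has a term in which it does not occur. *)
Lemma monomial_factor_trivial (T : idomainType) (n : nat) (m : 'X_{1..n}) (c : T)
    (F C : {mpoly T[n]}) :
  (forall j, exists2 u, F@_u != 0 & u j = 0%N) ->
  F = c *: 'X_[m] * C -> c *: 'X_[m] = c%:MP.
Proof.
move=> supp0 e; have -> : m = 0%MM; last by rewrite mpolyX0 alg_mpolyC.
apply/mnmP => j; rewrite mnm0E; have [u nzu uj] := supp0 j.
move: nzu; rewrite e -scalerAl mcoeffZ mulf_eq0 negb_or => /andP[_].
rewrite mulrC -mcoeff_msupp (perm_mem (msuppMX _ _)) => /mapP[m' _ eu].
by move: uj; rewrite eu mnmDE => /eqP; rewrite addn_eq0 => /andP[/eqP].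
Qed.

Section Reduction.
Variables (K : closedFieldType) (n l : nat).
Variables (P : {mpoly K[n]}) (Q : 'I_l -> {mpoly K[n]}).
Hypothesis n_ge2 : (2 <= n)%N.
Hypothesis l_ge2 : (2 <= l)%N.
Hypothesis Q_monomial : forall i, is_monomial (Q i).
Hypothesis PQ_coprime : relatively_prime P Q.
Hypothesis PQ_distinct : pairwise_distinct P Q.
Hypothesis PQ_not_line : ~ on_a_line (newton_points P Q).
Hypothesis PQ_not_pth_power : forall p : nat, p \in [pchar K] ->
  ~ is_pth_power p P \/ exists i, ~ is_pth_power p (Q i).

Let expo (i : 'I_l) : 'X_{1..n} := mlead (Q i).

Lemma Q_expo i : Q i = 'X_[expo i].
Proof. by have [m e] := Q_monomial i; rewrite /expo e mleadXm. Qed.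

Let expo_inj : injective expo.
Proof.
move=> i j e; apply/eqP; apply: contraT => ne.
case: PQ_distinct => _ /(_ i j ne) []; exists 1; first exact: oner_neq0.
by rewrite scale1r !Q_expo e.
Qed.

Definition family_supp : seq 'X_{1..n} :=
  undup (msupp P ++ [seq mlead (Q i) | i <- enum 'I_l]).
Local Notation S := family_supp.

Lemma mem_family_supp m :
  (m \in S) = (m \in msupp P) || (m \in [seq expo i | i <- enum 'I_l]).
Proof. by rewrite mem_undup mem_cat. Qed.

Lemma expo_supp i : expo i \in S.
Proof. by rewrite mem_family_supp; apply/orP; right; apply: map_f; rewrite mem_enum. Qed.

Lemma newton_supp m : newton_points P Q m -> m \in S.
Proof.
case=> [mP|[i]]; first by rewrite mem_family_supp mP.
by rewrite Q_expo msuppX inE => /eqP ->; apply: expo_supp.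
Qed.

Lemma supp_avoids_hyperplane (j : 'I_n) : exists2 m, m \in S & m j = 0%N.
Proof.
have [/hasP[m mS /eqP m0]|/hasPn none] := boolP (has (fun m : 'X_{1..n} => m j == 0%N) S).
  by exists m.
have gt0 m : m \in S -> (0 < m j)%N by move=> /none; rewrite lt0n.
have : tdeg ('X_j : {mpoly K[n]}) = 0%N.
  apply: PQ_coprime => [|i]; apply: dvd_mpolyX => m mp; apply: gt0; apply: newton_supp.
    by left.
  by right; exists i.
by rewrite /tdeg msizeX mdeg1.
Qed.

Lemma supp_separated (p : nat) : p \in [pchar K] ->
  exists m m' (j : 'I_n), [/\ m \in S, m' \in S & m j != m' j %[mod p]].
Proof.
move=> cp; pose bad (m : 'X_{1..n}) := [exists j : 'I_n, ~~ (p %| m j)%N].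
have [/hasP[m mS /existsP[j nd]]|/hasPn none] := boolP (has bad S).
  have [m' m'S m'j] := supp_avoids_hyperplane j.
  by exists m, m', j; split; rewrite // m'j mod0n.
have dvd_all m j : m \in S -> (p %| m j)%N.
  by move=> /none; rewrite negb_exists => /forallP/(_ j); rewrite negbK.
case: (PQ_not_pth_power cp) => [[]|[i []]]; apply: pth_power_of_dvd => // m j mp.
  by apply: dvd_all; apply: newton_supp; left.
by apply: dvd_all; apply: newton_supp; right; exists i.
Qed.

(** If all these identities held, every exponent m would be m1 + t (m2 - m1)
    with t the quotient of the weight of m - m1 by that of m2 - m1. *)
Lemma supp_off_line (m1 m2 : 'X_{1..n}) (w : 'I_n -> nat) :
  m1 != m2 -> (weight w m1 < weight w m2)%N ->
  exists2 m, m \in S & exists j : 'I_n,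
   ((weight w m2 - weight w m1) * m j + m1 j * weight w m + m2 j * weight w m1 !=
    (weight w m2 - weight w m1) * m1 j + m1 j * weight w m1 + m2 j * weight w m)%N.
Proof.
move=> ne lt12; set J := (_ - _)%N.
pose off (m : 'X_{1..n}) := [exists j : 'I_n,
   (J * m j + m1 j * weight w m + m2 j * weight w m1 !=
    J * m1 j + m1 j * weight w m1 + m2 j * weight w m)%N].
have [/hasP[m mS /existsP[j e]]|/hasPn none] := boolP (has off S).
  by exists m => //; exists j.
case: PQ_not_line.
exists (\row_j (m1 j)%:R), (\row_j ((m2 j)%:R - (m1 j)%:R)); split.
  apply: contra_neq ne => /rowP d0; apply/mnmP => j; apply/esym/eqP.
  by have := d0 j; rewrite !mxE => /eqP; rewrite subr_eq0 Num.Theory.eqr_nat.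
move=> m /newton_supp/none; rewrite negb_exists => /forallP onl.
exists (((weight w m)%:R - (weight w m1)%:R) / J%:R); apply/rowP => j.
rewrite !mxE; have := onl j; rewrite negbK => /eqP/(congr1 (fun k => k%:R : rat)).
have nzJ : (J%:R : rat) != 0 by rewrite Num.Theory.pnatr_eq0 -lt0n subn_gt0.
rewrite !natrD !natrM => e; apply: (mulfI nzJ); rewrite mulrDr mulrA.
rewrite [J%:R * (_ / _)]mulrC divfK //.
set x : rat := (weight w m)%:R in e *; set x1 : rat := (weight w m1)%:R in e *.
set y : rat := (m j)%:R in e *; set y1 : rat := (m1 j)%:R in e *.
set y2 : rat := (m2 j)%:R in e *; set k : rat := J%:R in e *.
have -> : k * y = k * y + y1 * x + y2 * x1 - y1 * x - y2 * x1 by ring.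
by rewrite e; ring.
Qed.

Definition specialized (T : idomainType) (f : K -> T) (v : 'I_l -> T) : {mpoly T[n]} :=
  map_mpoly f P + \sum_(i < l) v i *: map_mpoly f (Q i).

Definition supp_index (i : 'I_l) : seq_sub S := SeqSub (expo_supp i).

Lemma supp_index_inj : injective supp_index.
Proof. by move=> i j e; apply: expo_inj; exact: (congr1 (@ssval _ _) e). Qed.

Lemma mcoeff_specialized (T : idomainType) (f : {rmorphism K -> T}) v (s : seq_sub S) :
  (specialized f v)@_(val s) = coef_at (fun s : seq_sub S => P@_(val s)) supp_index f v s.
Proof.
rewrite /specialized mcoeffD mcoeff_map_mpoly /coef_at; congr (_ + _).
rewrite raddf_sum [RHS]big_mkcond; apply: eq_bigr => i _ /=.
rewrite mcoeffZ Q_expo map_mpolyX mcoeffX -[supp_index i == s](inj_eq val_inj) /=.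
by case: eqP => _; rewrite ?mulr1 ?mulr0.
Qed.

Lemma msupp_specialized (T : idomainType) (f : {rmorphism K -> T}) v m :
  m \in msupp (specialized f v) -> m \in S.
Proof.
apply: contraTT; rewrite mem_family_supp negb_or => /andP[mP mQ].
rewrite mcoeff_msupp negbK /specialized mcoeffD mcoeff_map_mpoly (memN_msupp_eq0 mP) raddf0 add0r.
rewrite raddf_sum big1 //= => i _; rewrite mcoeffZ Q_expo map_mpolyX mcoeffX.
case: eqP => [e|_]; last by rewrite mulr0.
by case/negP: mQ; rewrite -e; apply: map_f; rewrite mem_enum.
Qed.

Lemma specializedE (T : idomainType) (f : {rmorphism K -> T}) v : specialized f v =
  \sum_(s : seq_sub S) coef_at (fun s : seq_sub S => P@_(val s)) supp_index f v s *: 'X_[val s].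
Proof.
apply/mpolyP => m; rewrite raddf_sum /=.
have [mS|mNS] := boolP (m \in S).
  rewrite (bigD1 (SeqSub mS : seq_sub S)) //= mcoeffZ mcoeffX eqxx mulr1 -mcoeff_specialized /=.
  rewrite big1 ?addr0 // => s; rewrite -(inj_eq val_inj) /= => /negbTE ne.
  by rewrite mcoeffZ mcoeffX ne mulr0.
rewrite (memN_msupp_eq0 (contra (@msupp_specialized _ f v m) mNS)) big1 // => s _.
rewrite mcoeffZ mcoeffX; case: eqP => [e|_]; last by rewrite mulr0.
by case/negP: mNS; rewrite -e; apply: valP.
Qed.

Lemma gen_coef_supp_neq0 (s : seq_sub S) :
  gen_coef (fun s : seq_sub S => P@_(val s)) supp_index s != 0.
Proof.
have mU (i : 'I_l) : ('X_i : {mpoly K[l]})@_U_(i) = 1 by rewrite mcoeffX eqxx.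
have [i /eqP e|none] := pickP (fun i => supp_index i == s).
  apply/eqP => /(congr1 (mcoeff U_(i))); rewrite mcoeff0 mcoeffD mcoeffC raddf_sum.
  rewrite (bigD1 i) /=; last by rewrite e.
  rewrite mU big1 => [|j /andP[/eqP ej ne]].
    by rewrite addr0 mnm1_eq0 mulr0 add0r => /eqP; rewrite oner_eq0.
  by case/eqP: ne; apply: supp_index_inj; rewrite ej.
rewrite /gen_coef /coef_at big_pred0 // addr0 mpolyC_eq0 -mcoeff_msupp.
have := valP s; rewrite mem_family_supp => /orP[//|/mapP[i _ e]].
by have := none i; rewrite -(inj_eq val_inj) /= -e eqxx.
Qed.

(** Factors of F_v are sent to factors of the member of a two-variable family,
    after powers of y are removed; a factor whose image is free of y is a
    monomial, hence constant. *)
Lemma specialized_irreducible : exists2 g : {mpoly K[l]}, g != 0 &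
  forall (L : closedFieldType) (f : {rmorphism K -> L}) (v : 'I_l -> L),
    mmap f v g != 0 -> irreducible (specialized f v).
Proof.
(* A bound for the exponents of all factors of all members. *)
pose B := (\max_(m <- S) mdeg m).+1.
have ltB m : m \in S -> (mdeg m < B)%N by move=> mS; rewrite ltnS; apply: leq_bigmax_seq.
have ltBk m k : m \in S -> (m k < B)%N.
  by move=> /ltB; apply: leq_ltn_trans; rewrite mdegE (bigD1 k) //= leq_addr.
pose k1 : 'I_l := Ordinal (ltnW l_ge2); pose k2 : 'I_l := Ordinal l_ge2.
have nek : expo k1 != expo k2 by rewrite (inj_eq expo_inj).
have [w [w_inj sepw]] := separating_weights (Ordinal (ltnW n_ge2)) (expo_supp k1)
  (expo_supp k2) nek ltBk supp_separated.
have w_injS m m' : m \in S -> m' \in S -> weight w m = weight w m' -> m = m'.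
  by move=> mS m'S; apply: w_inj => k; apply: ltBk.
have [i1 [i2 lt12]] : exists i1 i2, (weight w (expo i1) < weight w (expo i2))%N.
  have [lt|gt|e] := ltngtP (weight w (expo k1)) (weight w (expo k2)).
  - by exists k1, k2.
  - by exists k2, k1.
  - by case/eqP: nek; apply: w_injS e; apply: expo_supp.
have ne12 : expo i1 != expo i2 by apply: contraTneq lt12 => ->; rewrite ltnn.
have [mt mtS [j0 off]] := supp_off_line ne12 lt12.
pose I := seq_sub S.
pose s1 : I := supp_index i1; pose s2 : I := supp_index i2; pose st : I := SeqSub mtS.
pose wS (s : I) := weight w (val s).
have [s0 _ min0] := arg_minnP wS (isT : xpredT s1).
have [sd _ maxd] := arg_maxnP wS (isT : xpredT s1).
pose mu := wS s0; pose b (s : I) := (wS s - mu)%N.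
have bE s : wS s = (b s + mu)%N by rewrite subnK // min0.
pose J := (weight w (expo i2) - weight w (expo i1))%N.
pose a (s : I) := (J * (val s) j0)%N.
have J_gt0 : (0 < J)%N by rewrite subn_gt0.
have bs2 : b s2 = (b s1 + J)%N.
  apply: (@addIn mu); rewrite -bE addnAC -bE /wS /= /J.
  by rewrite subnKC // ltnW.
have b_inj : injective b.
  move=> x y e; apply: val_inj; apply: w_injS; [exact: valP|exact: valP|].
  by rewrite -/(wS x) -/(wS y) !bE e.
have off' : (a st + expo i1 j0 * b st + expo i2 j0 * b s1 !=
             a s1 + expo i1 j0 * b s1 + expo i2 j0 * b st)%N.
  apply: contra_neq off; rewrite -/J -/(wS st) -/(wS s1) !bE /a /=.
  by rewrite !mulnDr; lia.
have sep' : exists s, (b s)%:R != (b s1)%:R :> K.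
  have [m [m' [mS m'S ne]]] := sepw.
  have [e1|] := eqVneq ((b (SeqSub mS))%:R : K) (b s1)%:R; last by exists (SeqSub mS).
  have [e2|] := eqVneq ((b (SeqSub m'S))%:R : K) (b s1)%:R; last by exists (SeqSub m'S).
  case/eqP: ne; rewrite -[weight w m]/(wS (SeqSub mS)) -[weight w m']/(wS (SeqSub m'S)).
  by rewrite !bE !natrD e1 e2.
have bmax s : (b s <= b sd)%N by apply: leq_sub2r; apply: maxd.
have bs0 : b s0 = 0%N by rewrite /b subnn.
have [g nzg gP] := family_irreducible gen_coef_supp_neq0 b_inj
  (i1 := i1) (i2 := i2) J_gt0 bs2 (erefl _) (erefl _) bmax bs0 off' sep' (a := a).
exists (g * \prod_s gen_coef (fun s : I => P@_(val s)) supp_index s).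
  by rewrite mulf_neq0 //; apply/prodf_neq0 => s _; apply: gen_coef_supp_neq0.
move=> L f v; rewrite rmorphM mulf_eq0 negb_or => /andP[/gP{}gP].
rewrite rmorph_prod => /prodf_neq0 nz_coef.
have {}nz_coef (s : I) : (specialized f v)@_(val s) != 0.
  by rewrite mcoeff_specialized -eval_gen_coef; apply: nz_coef.
have nzF : specialized f v != 0.
  by apply: contraNneq (nz_coef s1) => ->; rewrite mcoeff0.
have supp0 j : exists2 u, (specialized f v)@_u != 0 & u j = 0%N.
  by have [m mS mj] := supp_avoids_hyperplane j; exists m => //; apply: (nz_coef (SeqSub mS)).
have szF : (msize (specialized f v) <= B)%N.
  rewrite msizeE; apply/bigmax_leqP_seq => m /msupp_specialized mS _; exact: ltB.
split=> // [|A C eAC].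
  apply/negP => /andP[/eqP eF _]; have := nz_coef s1; have := nz_coef s2.
  rewrite eF !mcoeffC !mulf_eq0 !negb_or => /andP[_ z2] /andP[_ z1].
  have aux (m : 'X_{1..n}) : (m == 0%MM)%:R != 0 :> L -> m = 0%MM.
    by case: (m =P 0%MM) => // _; rewrite eqxx.
  by case/eqP: ne12; exact: (etrans (aux _ z1) (esym (aux _ z2))).
have [nzA nzC] : A != 0 /\ C != 0 by apply/andP; rewrite -negb_or -mulf_eq0 -eAC.
have sA : (0 < msize A)%N by rewrite lt0n msize_poly_eq0.
have sC : (0 < msize C)%N by rewrite lt0n msize_poly_eq0.
have eSz : msize (specialized f v) = (msize A + msize C).-1 by rewrite eAC msizeM.
have szA : (msize A <= B)%N by apply: leq_trans szF; rewrite eSz; lia.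
have szC : (msize C <= B)%N by apply: leq_trans szF; rewrite eSz; lia.
pose sub := monomial_subst J j0 w L.
have subF : sub (specialized f v) =
    family_poly a b (fun s : I => P@_(val s)) supp_index f v * 'X^mu.
  rewrite specializedE rmorph_sum mulr_suml; apply: eq_bigr => s _ /=.
  rewrite monomial_substX /monXY -mulrA -exprD; congr (_ * 'X^_).
  exact: bE.
have nzsA : sub A != 0 := subst_neq0 J j0 w_inj szA nzA.
have nzsC : sub C != 0 := subst_neq0 J j0 w_inj szC nzC.
have [A0 [k [eA A00]]] := strip_Xn nzsA.
have [C0 [k' [eC C00]]] := strip_Xn nzsC.
have fam0 : (family_poly a b (fun s : I => P@_(val s)) supp_index f v)`_0 != 0.
  rewrite coef_sum (bigD1 s0) //= coef_monXY bs0 eqxx scale1r big1 ?addr0 => [|s ne].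
    rewrite -mul_polyC mulf_eq0 polyC_eq0 (negbTE (monic_neq0 (monicXn _ _))) orbF.
    by rewrite -mcoeff_specialized.
  rewrite coef_monXY -bs0 eq_sym (inj_eq b_inj) (negbTE ne) scale0r //.
have eFam : family_poly a b (fun s : I => P@_(val s)) supp_index f v = A0 * C0.
  apply: (@strip_Xn_uniq _ _ _ mu (k + k')) => //.
    by rewrite coef0M mulf_neq0.
  by rewrite -subF eAC rmorphM /= eA eC exprD mulrACA.
(* A factor whose image involves a single power of y is a unit. *)
have half D E D0 r : D != 0 -> (msize D <= B)%N -> specialized f v = D * E ->
    sub D = D0 * 'X^r -> (size D0 <= 1)%N -> D \is a GRing.unit.
  move=> nzD szD eDE eD sD0; rewrite (size1_polyC sD0) in eD.
  have [m [c0 eDm]] := subst_monomial w_inj szD nzD eD.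
  have eDc : D = c0%:MP by rewrite eDm; apply: monomial_factor_trivial supp0 _; rewrite -eDm; exact: eDE.
  have nzc : c0 != 0 by apply: contra_neq nzD => c00; rewrite eDc c00 mpolyC0.
  by rewrite eDc; apply: rmorph_unit; rewrite unitfE.
have [sA0|sC0] := gP _ _ eFam.
  by left; apply: (half A C A0 k).
by right; apply: (half C A C0 k') => //; rewrite mulrC.
Qed.

End Reduction.

(** * The theorem *)

Theorem theorem1p3 (K : closedFieldType) (n l : nat)
    (P : {mpoly K[n]}) (Q : 'I_l -> {mpoly K[n]})
    (n_ge2 : (2 <= n)%N) (l_ge2 : (2 <= l)%N)
    (P_nonconst : (0 < tdeg P)%N)
    (Q_monomial : forall i, is_monomial (Q i))
    (Q_degree : forall i, (tdeg (Q i) <= tdeg P)%N)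
    (PQ_coprime : relatively_prime P Q)
    (PQ_distinct : pairwise_distinct P Q)
    (PQ_not_line : ~ on_a_line (newton_points P Q))
    (PQ_not_pth_power : forall p : nat, p \in [pchar K] ->
       ~ is_pth_power p P \/ exists i, ~ is_pth_power p (Q i)) :
  irreducible_over_closure (generic_poly P Q) /\
  exists U : ('I_l -> K) -> Prop,
    [/\ zariski_open U,
        (exists v, U v) &
        forall v, U v -> irreducible (specialized_poly P Q v)].
Proof.
have [g nzg gP] := specialized_irreducible n_ge2 l_ge2 Q_monomial PQ_coprime
  PQ_distinct PQ_not_line PQ_not_pth_power.
split=> [L iota _|].
  pose emb : {rmorphism {mpoly K[l]} -> L} := iota \o @tofrac {mpoly K[l]}.
  have -> : map_mpoly iota (generic_poly P Q) =
      specialized P Q (emb \o @mpolyC l K) (emb \o (fun i => 'X_i)).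
    have mapE (p : {mpoly K[n]}) : map_mpoly iota (map_mpoly (@param_const K l) p) =
        map_mpoly (emb \o @mpolyC l K) p.
      apply/mpolyP => m; rewrite !mcoeff_map_mpoly /=.
      by have -> := @mcoeff_map_mpoly n _ _ (@tofrac {mpoly K[l]} \o @mpolyC l K) m p.
    rewrite /generic_poly rmorphD /specialized; congr (_ + _); first exact: mapE.
    by rewrite rmorph_sum; apply: eq_bigr => i _; rewrite /= map_mpolyZ mapE.
  apply: gP; rewrite -rmorph_mmap mmap_id_mpoly /emb /= fmorph_eq0 tofrac_eq0 //.
exists (fun v => g.@[v] != 0); split.
- exists (eq g) => v; split=> [nz|[_ <-] //]; first by exists g.
- exact: mpoly_nonroot.
move=> v nzv; have := gP K idfun v nzv.
have mapE p : map_mpoly idfun p = p :> {mpoly K[n]}.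
  by apply/mpolyP => m; rewrite mcoeff_map_mpoly.
rewrite /specialized /specialized_poly mapE.
by under eq_bigr do rewrite mapE.
Qed.
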